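(* Let $X,Y$ be bounded convex open subsets of $\mathbb{R}^d$, $\mu\in P(X)$, and $\nu\in P(Y)$ absolutely continuous with respect to Lebesgue measure with density bounded away from zero on $Y$. Then there exists a subharmonic function $\psi_0$ on $Y$, bounded from below, with $\psi_0\in L^1(Y,d\nu)$, such that $$\mathcal{D}_2(\mu,\mathrm{P}^{sh}_{\le\nu}):=\sup_{\psi\in\mathcal{A}_{sh}\cap C_b(Y)}\Big\{\int_X Q_2(\psi)\,d\mu-\int_Y\psi\,d\nu\Big\}\le\int_X Q_2(\psi_0)\,d\mu-\int_Y\psi_0\,d\nu.$$ If moreover $\bar\mu$ denotes a minimizer of $\mathcal{T}_2(\mu,\cdot)$ over $\mathrm{P}^{sh}_{\le\nu}$ and $\int_Y\psi_0\,d\bar\mu\le\int_Y\psi_0\,d\nu$, then equality holds, i.e. $\psi_0$ attains $\mathcal{D}_2(\mu,\mathrm{P}^{sh}_{\le\nu})$.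
   Context: Subharmonic on an open $U$: upper semicontinuous, values in $[-\infty,\infty)$, sub-mean-value inequality over every sphere $\partial B_r(x_0)$ with $B_r(x_0)\subset U$. For $\eta,\xi\in P(Y)$, $\eta\le_{sh}\xi$ means $\int\psi\,d\eta\le\int\psi\,d\xi$ for all subharmonic $\psi\in C_b(Y)$. $\mathcal{A}_{sh}$: subharmonic functions bounded from below. $\mathrm{P}^{sh}_{\le\nu}=\{\eta\in P(Y):\eta\le_{sh}\nu\}$. $Q_2(\psi)(x)=\inf_{y\in Y}\{\psi(y)+|x-y|^2\}$. $\mathcal{T}_2(\alpha,\beta)=\inf_{\pi\in\Pi(\alpha,\beta)}\int|x-y|^2d\pi$. *)

(* Defs.v *)
(* R^d is modelled as [d.-tuple R]
   (R : realType), which MathComp-Analysis equips with the product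
   sigma-algebra generated by the coordinate projections (= Borel sets of
   R^d).  The Euclidean structure is written out explicitly. *)
From mathcomp Require Import all_boot all_order all_algebra.
From mathcomp Require Import all_classical all_reals all_analysis.
Set Implicit Arguments. Unset Strict Implicit. Unset Printing Implicit Defensive.
Import Order.TTheory GRing.Theory Num.Theory.
Local Open Scope classical_set_scope.
Local Open Scope ring_scope.

Section Defs.
Variables (R : realType) (d : nat).
Local Notation V := (d.-tuple R).

Definition sqdist (x y : V) : R := \sum_(i < d) (tnth x i - tnth y i) ^+ 2.
Definition origin : V := [tuple (0 : R) | _ < d].
Definition enorm (x : V) : R := Num.sqrt (sqdist x origin).
Definition oball (x : V) (r : R) : set V := [set y | sqdist x y < r ^+ 2].
Definition cball (x : V) (r : R) : set V := [set y | sqdist x y <= r ^+ 2].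

Definition eopen (U : set V) : Prop :=
  forall x, U x -> exists2 r : R, 0 < r & oball x r `<=` U.
Definition ebounded (U : set V) : Prop :=
  exists M : R, forall x, U x -> enorm x <= M.
Definition conv_comb (t : R) (x y : V) : V :=
  [tuple (1 - t) * tnth x i + t * tnth y i | i < d].
Definition econvex (U : set V) : Prop :=
  forall x y t, U x -> U y -> 0 <= t <= 1 -> U (conv_comb t x y).

Definition sph_point (x0 : V) (r : R) (z : V) : V :=
  [tuple tnth x0 i + r * (tnth z i / enorm z) | i < d].

(* [leb] is Lebesgue measure on R^d: the (unique) measure on the Borel sets
   giving every closed box its volume. *)
Definition is_lebesgue (leb : {measure set V -> \bar R}) : Prop :=
  forall a b : V, (forall i, tnth a i <= tnth b i) ->
    leb [set x | forall i, tnth a i <= tnth x i <= tnth b i] =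
    (\prod_(i < d) (tnth b i - tnth a i))%:E.

(* Mean of f over the sphere dB_r(x0) w.r.t. normalized surface measure.
   Normalized surface measure on the unit sphere is the push-forward of
   normalized Lebesgue measure on the unit ball by z |-> z/|z|. *)
Definition sphere_mean (leb : {measure set V -> \bar R}) (f : V -> \bar R)
  (x0 : V) (r : R) : \bar R :=
  ((fine (leb (oball origin 1)))^-1)%:E *
  (\int[leb]_(z in oball origin 1) f (sph_point x0 r z))%E.

Definition usc_on (U : set V) (f : V -> \bar R) : Prop :=
  forall x, U x -> forall t : R, (f x < t%:E)%E ->
    exists2 r : R, 0 < r & forall y, U y -> oball x r y -> (f y < t%:E)%E.

Definition subharmonic (leb : {measure set V -> \bar R}) (U : set V)
  (f : V -> \bar R) : Prop :=
  [/\ (forall x, U x -> f x != +oo%E),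
      usc_on U f &
      forall x0 (r : R), 0 < r -> cball x0 r `<=` U ->
        (f x0 <= sphere_mean leb f x0 r)%E].

Definition bounded_below_on (U : set V) (f : V -> \bar R) : Prop :=
  exists M : R, forall x, U x -> (M%:E <= f x)%E.

Definition Cb (Y : set V) (f : V -> R) : Prop :=
  (forall x, Y x -> forall e : R, 0 < e -> exists2 del : R, 0 < del &
     forall y, Y y -> oball x del y -> `|f x - f y| < e) /\
  (exists M : R, forall y, Y y -> `|f y| <= M).

Definition sh_Cb (leb : {measure set V -> \bar R}) (Y : set V) (psi : V -> R) :=
  Cb Y psi /\ subharmonic leb Y (fun x => (psi x)%:E).

Definition Q2 (Y : set V) (psi : V -> \bar R) (x : V) : \bar R :=
  ereal_inf [set (psi y + (sqdist x y)%:E)%E | y in Y].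

Definition probs_on (Y : set V) : set (probability V R) := [set P | P Y = 1%E].

Definition sh_le (leb : {measure set V -> \bar R}) (Y : set V)
  (eta xi : probability V R) : Prop :=
  forall psi, sh_Cb leb Y psi ->
    (\int[eta]_(y in Y) (psi y)%:E <= \int[xi]_(y in Y) (psi y)%:E)%E.

Definition Psh_le (leb : {measure set V -> \bar R}) (Y : set V)
  (nu : probability V R) : set (probability V R) :=
  [set eta | probs_on Y eta /\ sh_le leb Y eta nu].

Definition couplings (alpha beta : probability V R) :
  set (probability (V * V)%type R) :=
  [set pi | (forall A, measurable A -> pi (A `*` setT) = alpha A) /\
            (forall B, measurable B -> pi (setT `*` B) = beta B)].

Definition T2 (alpha beta : probability V R) : \bar R :=
  ereal_inf [set (\int[pi]_z (sqdist z.1 z.2)%:E)%E | pi in couplings alpha beta].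

Definition Jfun (X Y : set V) (mu nu : probability V R) (psi : V -> \bar R)
  : \bar R :=
  (\int[mu]_(x in X) Q2 Y psi x - \int[nu]_(y in Y) psi y)%E.

Definition D2 (leb : {measure set V -> \bar R}) (X Y : set V)
  (mu nu : probability V R) : \bar R :=
  ereal_sup [set Jfun X Y mu nu (fun y => (psi y)%:E) | psi in sh_Cb leb Y].

End Defs.

(* Main.v *)
(* A maximizing sequence psi_n is normalized to infimum 0, so that its nu-mass is bounded.  The dual
   functional J is concave, hence its near-maximizers form decreasing convex sets; almost minimizing
   the integral of exp(-h) over them produces a maximizing sequence h_n that is Cauchy in measure,
   and in L^1_loc because the sub-mean-value property over balls and the lower bound on the density
   make h_n locally bounded.  Its upper limit p, taken jointly in n and in the point, is upper
   semicontinuous, dominates limsup h_n, inherits the spherical sub-mean-value inequality by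
   Fatou's lemma, and satisfies int p dnu <= liminf int h_n dnu, because it is bounded by ball
   averages of h_n.  As p dominates limsup h_n, int Q2(p) dmu >= limsup int Q2(h_n) dmu, whence
   D2 <= J(p).

   The equality is obtained without duality: J(0) <= D2 <= J(p), and along the segment t p some t
   in [0, 1] satisfies J(t p) = D2 exactly, so psi_0 := t p attains D2 for every mubar. *)
From HB Require Import structures.
Require Import Defs.
From mathcomp Require Import all_boot all_order all_algebra.
From mathcomp Require Import all_classical all_reals all_analysis.
From mathcomp Require Import measurable_realfun ring lra.
Set Implicit Arguments. Unset Strict Implicit. Unset Printing Implicit Defensive.
Import Order.TTheory GRing.Theory Num.Theory.
Import numFieldNormedType.Exports.
Local Open Scope classical_set_scope.
Local Open Scope ring_scope.

(** * Euclidean geometry of tuples *)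

(** Normalized maximizing sequences are bounded only in L^1(nu), which gives no weak compactness.
    Strict convexity serves instead: the integral of exp(-h) is finite for every nonnegative h,
    whatever its size, and almost minimizing it yields strong convergence without extracting
    subsequences. The pointwise limit superior need not be upper semicontinuous; the joint one is by
    construction, at the price of possibly being larger, so its integral has to be controlled
    separately. That control lives in L^1(leb) well inside Y, whereas the density of nu may be
    unbounded above; hence the exhaustion [core] of Y by sets where the density is bounded. The
    limit p need not be bounded or continuous, so it is not a competitor in [D2] and J(p) may a
    priori exceed the supremum; this is why a point of the segment from 0 to p is selected.
    Boundedness of X and Y provides a bound D for [sqdist] between them, so that on X the transform
    of a function with infimum 0 takes values in [0, D]. *)

Section Geometry.
Variables (R : realType) (d : nat).
Local Notation V := (d.-tuple R).
Implicit Types (x y z a b : V) (r s t : R).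

(** The same map gives translations ([s = 1]) and dilations, so that [leb_vaff] is the only change
    of variables to prove; [sph_pointE] writes points of spheres with it too. *)
Definition vaff a s z : V := [tuple tnth a i + s * tnth z i | i < d].
Definition eudist x y : R := Num.sqrt (sqdist x y).

Lemma sqdist_ge0 x y : 0 <= sqdist x y.
Proof. by apply: sumr_ge0 => i _; exact: sqr_ge0. Qed.

Lemma eudist_ge0 x y : 0 <= eudist x y. Proof. exact: sqrtr_ge0. Qed.

Lemma eudist_sqr x y : eudist x y ^+ 2 = sqdist x y.
Proof. by rewrite sqr_sqrtr ?sqdist_ge0. Qed.

Lemma sqdistC x y : sqdist x y = sqdist y x.
Proof. by apply: eq_bigr => i _; rewrite -sqrrN opprB. Qed.

Lemma eudistC x y : eudist x y = eudist y x.
Proof. by rewrite /eudist sqdistC. Qed.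

Lemma sqdistxx x : sqdist x x = 0.
Proof. by rewrite /sqdist big1 // => i _; rewrite subrr expr0n. Qed.

Lemma eudistxx x : eudist x x = 0.
Proof. by rewrite /eudist sqdistxx sqrtr0. Qed.

Lemma eudist0_eq x y : eudist x y = 0 -> x = y.
Proof.
move=> /(congr1 (fun u => u ^+ 2)); rewrite eudist_sqr expr0n /=.
move=> /eqP; rewrite psumr_eq0; last by move=> i _; exact: sqr_ge0.
move=> /allP h; apply: eq_from_tnth => i; apply/eqP.
by have := h i (mem_index_enum _); rewrite sqrf_eq0 subr_eq0.
Qed.

(* (a + b)^2 <= (1 + t) a^2 + (1 + 1/t) b^2, summed over the coordinates with the optimal t *)
Lemma eudist_triangle x y z : eudist x z <= eudist x y + eudist y z.
Proof.
have [|A0] := eqVneq (eudist x y) 0.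
  by move=> /[dup] /eudist0_eq -> ->; rewrite add0r.
have [|B0] := eqVneq (eudist y z) 0.
  by move=> /[dup] /eudist0_eq -> ->; rewrite addr0.
have {}A0 : 0 < eudist x y by rewrite lt_def A0 eudist_ge0.
have {}B0 : 0 < eudist y z by rewrite lt_def B0 eudist_ge0.
have hAB : 0 <= eudist x y + eudist y z by apply: addr_ge0; exact: ltW.
rewrite -(ler_pXn2r (n := 2)) ?nnegrE ?eudist_ge0 //.
pose A := eudist x y; pose B := eudist y z; pose t := B / A.
have t0 : 0 < t by rewrite divr_gt0.
have -> : (eudist x y + eudist y z) ^+ 2 =
    (1 + t) * sqdist x y + (1 + t^-1) * sqdist y z.
  rewrite -!eudist_sqr -/A -/B /t invf_div; field.
  by rewrite !gt_eqF.
rewrite eudist_sqr /sqdist !mulr_sumr -big_split /=; apply: ler_sum => i _.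
set u := tnth x i; set v := tnth y i; set w := tnth z i.
rewrite -subr_ge0.
have -> : (1 + t) * (u - v) ^+ 2 + (1 + t^-1) * (v - w) ^+ 2 - (u - w) ^+ 2 =
   t^-1 * (t * (u - v) - (v - w)) ^+ 2 by field; rewrite gt_eqF.
by rewrite mulr_ge0 ?sqr_ge0 // invr_ge0 ltW.
Qed.

Lemma coord_le_eudist x y i : `|tnth x i - tnth y i| <= eudist x y.
Proof.
rewrite -(ler_pXn2r (n := 2)) ?nnegrE ?eudist_ge0 // eudist_sqr -normrX.
rewrite ger0_norm ?sqr_ge0 // /sqdist (bigD1 i) //= lerDl.
by apply: sumr_ge0 => j _; exact: sqr_ge0.
Qed.

Lemma eudist_le_coord x y e : 0 <= e ->
  (forall i, `|tnth x i - tnth y i| <= e) -> eudist x y <= d%:R * e.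
Proof.
move=> e0 h; rewrite -(ler_pXn2r (n := 2)) ?nnegrE ?eudist_ge0 ?mulr_ge0 //.
rewrite eudist_sqr; apply: (@le_trans _ _ (\sum_(i < d) e ^+ 2)).
  apply: ler_sum => i _; rewrite -[_ ^+ 2]ger0_norm ?sqr_ge0 // normrX.
  by rewrite ler_pXn2r ?nnegrE.
rewrite sumr_const card_ord -[in leLHS]mulr_natl exprMn ler_wpM2r ?sqr_ge0 //.
by rewrite -natrX ler_nat; case: d => // n; rewrite expnS leq_pmulr.
Qed.

(** The divisor [d.+1] makes the inequality strict, since [d / d.+1 < 1], and stays meaningful for
    [d = 0]. *)
Lemma eudist_lt_coord x y e : 0 < e ->
  (forall i, `|tnth x i - tnth y i| <= e / d.+1%:R) -> eudist x y < e.
Proof.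
move=> e0 h; apply: le_lt_trans (eudist_le_coord _ h) _.
  by rewrite divr_ge0 // ltW.
by rewrite mulrCA -[ltRHS]mulr1 ltr_pM2l // ltr_pdivrMr // mul1r ltr_nat.
Qed.

Lemma oballE x r y : 0 < r -> oball x r y <-> eudist x y < r.
Proof.
move=> r0; rewrite /oball /= -eudist_sqr.
by rewrite ltr_pXn2r ?nnegrE ?eudist_ge0 // ltW.
Qed.

Lemma cballE x r y : 0 <= r -> cball x r y <-> eudist x y <= r.
Proof. by move=> r0; rewrite /cball /= -eudist_sqr ler_pXn2r ?nnegrE ?eudist_ge0. Qed.

Lemma enormE x : enorm x = eudist x (origin R d). Proof. by []. Qed.

Lemma tnth_origin i : tnth (origin R d) i = 0. Proof. by rewrite tnth_mktuple. Qed.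

Lemma tnth_vaff a s z i : tnth (vaff a s z) i = tnth a i + s * tnth z i.
Proof. by rewrite tnth_mktuple. Qed.

Lemma vaff0 a z : vaff a 0 z = a.
Proof. by apply: eq_from_tnth => i; rewrite tnth_vaff mul0r addr0. Qed.

Lemma eudist_vaff a s z s' : eudist (vaff a s z) (vaff a s' z) = `|s - s'| * enorm z.
Proof.
rewrite /enorm /eudist -sqrtr_sqr -sqrtrM ?sqr_ge0 //; congr Num.sqrt.
rewrite /sqdist mulr_sumr; apply: eq_bigr => i _.
by rewrite !tnth_vaff tnth_origin; ring.
Qed.

Lemma eudist_vaff_center a b s z : eudist (vaff a s z) (vaff b s z) = eudist a b.
Proof.
congr Num.sqrt; apply: eq_bigr => i _; rewrite !tnth_vaff.
by congr (_ ^+ 2); ring.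
Qed.

Lemma eudist_vaffl a s z : eudist a (vaff a s z) = `|s| * enorm z.
Proof. by rewrite -{1}(vaff0 a z) eudist_vaff sub0r normrN. Qed.

Lemma sph_pointE a r z : sph_point a r z = vaff a (r / enorm z) z.
Proof.
by apply: eq_from_tnth => i; rewrite !tnth_mktuple mulrAC mulrA.
Qed.

Lemma eudist_sph_point a r z : 0 <= r -> eudist a (sph_point a r z) <= r.
Proof.
move=> r0; rewrite sph_pointE eudist_vaffl normrM normfV.
rewrite (ger0_norm r0) (ger0_norm (eudist_ge0 _ _)).
have [->|z0] := eqVneq (enorm z) 0; first by rewrite mulr0.
by rewrite divfK.
Qed.

Lemma eudist_sph_center a b r z : eudist (sph_point a r z) (sph_point b r z) = eudist a b.
Proof. by rewrite !sph_pointE eudist_vaff_center. Qed.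

Lemma enorm_vaff0 s z : enorm (vaff (origin R d) s z) = `|s| * enorm z.
Proof. by rewrite enormE eudistC eudist_vaffl. Qed.

(** Only the direction of [z] matters. At [z = 0] the convention that the inverse of 0 is 0 sends
    both sides to the centre [a]. *)
Lemma sph_point_scale a r s z : 0 < s ->
  sph_point a r (vaff (origin R d) s z) = sph_point a r z.
Proof.
move=> s0; rewrite !sph_pointE; apply: eq_from_tnth => i.
rewrite !tnth_vaff tnth_origin add0r enorm_vaff0 gtr0_norm //.
congr (_ + _); have [->|z0] := eqVneq (enorm z) 0.
  by rewrite !mulr0 invr0 !mulr0 !mul0r.
by field; rewrite z0 gt_eqF.
Qed.

End Geometry.

(** * Borel measurability of Euclidean constructions *)

Section Measurability.
Variables (R : realType) (d : nat).
Local Notation V := (d.-tuple R).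
Implicit Types (x y z a b : V) (r s t : R).

Lemma natSinv_lt (e : R) : 0 < e -> exists N, forall n, (N <= n)%N -> n.+1%:R^-1 < e.
Proof.
move=> e0; have [N _ hN] := near_infty_natSinv_lt (PosNum e0).
by exists N => n; exact: hN.
Qed.

Lemma measurable_sqdist dT (T : measurableType dT) (f g : T -> V) :
  measurable_fun setT f -> measurable_fun setT g ->
  measurable_fun setT (fun u => sqdist (f u) (g u)).
Proof.
move=> /measurable_fun_tnthP mf /measurable_fun_tnthP mg.
apply: measurable_sum => i; apply: measurable_funX; apply: measurable_funB.
- exact: mf.
- exact: mg.
Qed.

Lemma measurable_fun_sqrt : measurable_fun [set: R] Num.sqrt.
Proof. by apply: continuous_measurable_fun; exact: sqrt_continuous. Qed.

Lemma measurable_eudist dT (T : measurableType dT) (f g : T -> V) :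
  measurable_fun setT f -> measurable_fun setT g ->
  measurable_fun setT (fun u => eudist (f u) (g u)).
Proof.
move=> mf mg; apply: (measurableT_comp _ (measurable_sqdist mf mg)).
exact: measurable_fun_sqrt.
Qed.

Lemma measurable_vaff dT (T : measurableType dT) (f g : T -> V) (s : T -> R) :
  measurable_fun setT f -> measurable_fun setT s -> measurable_fun setT g ->
  measurable_fun setT (fun u => vaff (f u) (s u) (g u)).
Proof.
move=> /measurable_fun_tnthP mf ms /measurable_fun_tnthP mg.
apply/measurable_fun_tnthP => i.
rewrite (_ : _ \o _ = fun u => tnth (f u) i + s u * tnth (g u) i); last first.
  by apply/funext => u /=; rewrite tnth_vaff.
by apply: measurable_funD; [exact: mf|apply: measurable_funM => //; exact: mg].
Qed.

Lemma measurable_enorm : measurable_fun setT (@enorm R d).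
Proof. exact: (measurable_eudist (f := id) (g := cst (origin R d))). Qed.

Lemma measurable_sph_point a r : measurable_fun setT (sph_point a r).
Proof.
(* The inverse becomes the power -1, a measurable function on the whole line; the two agree on
   nonnegative reals, 0 included. *)
rewrite (_ : sph_point a r = fun z => vaff a (r * (enorm z `^ (- 1))) z); last first.
  by apply/funext => z; rewrite sph_pointE powR_inv1 // eudist_ge0.
apply: measurable_vaff => //; apply: measurable_funM => //.
by apply: (measurableT_comp (measurable_powR _)); exact: measurable_enorm.
Qed.

Lemma measurable_oball x r : measurable (oball x r).
Proof.
rewrite (_ : oball x r = setT `&` (fun y => sqdist x y) @^-1` `]-oo, r ^+ 2[%classic).
  apply: measurable_sqdist => //; exact: measurable_cst.
by rewrite setTI; apply/seteqP; split => y /=; rewrite in_itv.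
Qed.

(** The sigma-algebra is generated by the coordinates, so this needs separability: an open set is
    the countable union of those balls with rational centre and radius [n.+1%:R^-1] that it
    contains. *)
Lemma eopen_measurable (U : set V) : eopen U -> measurable U.
Proof.
move=> oU.
pose q2v (q : d.-tuple rat) : V := [tuple ratr (tnth q i) | i < d].
pose F (p : d.-tuple rat * nat) : set V :=
  if pselect (oball (q2v p.1) (p.2.+1%:R^-1) `<=` U) is left _
  then oball (q2v p.1) (p.2.+1%:R^-1) else set0.
rewrite (_ : U = \bigcup_p F p).
  apply: countable_bigcupT_measurable => [|p].
    exact: countableP.
  by rewrite /F; case: pselect => // _; exact: measurable_oball.
apply/seteqP; split => [x Ux|x [p _]]; last first.
  by rewrite /F; case: pselect => // h; exact: h.
have [r r0 hr] := oU x Ux.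
have [n hn] : exists n : nat, n.+1%:R^-1 < r / 2.
  by have [n hn] := natSinv_lt (divr_gt0 r0 (ltr0Sn R 1)); exists n; exact: hn.
have h0 : 0 < n.+1%:R^-1 :> R by rewrite invr_gt0.
have e0 : 0 < n.+1%:R^-1 / d.+1%:R :> R by rewrite divr_gt0.
have hq (i : 'I_d) : exists q : rat, `|tnth x i - ratr q| <= n.+1%:R^-1 / d.+1%:R.
  move: e0; set e := _ / _ => e0.
  have [|q /=] := @rat_in_itvoo R (tnth x i) (tnth x i + e); first by rewrite ltrDl.
  rewrite in_itv /= => /andP[h1 h2]; exists q.
  by rewrite ler_norml; apply/andP; split; lra.
have [q {}hq] := choice hq.
pose Q := [tuple q i | i < d].
have xQ : eudist x (q2v Q) < n.+1%:R^-1.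
  by apply: eudist_lt_coord => // i; rewrite !tnth_mktuple.
exists (Q, n) => //; rewrite /F; case: pselect => /= [_|]; first by apply/oballE => //; rewrite eudistC.
case => y /oballE - /(_ h0) yQ; apply: hr; apply/oballE => //.
apply: le_lt_trans (eudist_triangle x (q2v Q) y) _.
by rewrite (splitr r) ltrD // (lt_trans _ hn).
Qed.

Lemma measurable_fun_lt dT (T : measurableType dT) (f : T -> \bar R) :
  (forall t, measurable [set u | (f u < t%:E)%E]) -> measurable_fun setT f.
Proof.
move=> h; apply: (measurability _ (ErealGenInftyO.measurableE R)).
move=> _ [_ [t ->] <-]; rewrite setTI.
by rewrite (_ : _ @^-1` _ = [set u | (f u < t%:E)%E]).
Qed.

Lemma measurable_funR_lt dT (T : measurableType dT) (f : T -> R) :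
  (forall t, measurable [set u | f u < t]) -> measurable_fun setT f.
Proof.
by move=> h; apply/measurable_EFinP; apply: measurable_fun_lt => t /=; exact: h.
Qed.

(** For [0 < t] the strict sublevel set is the complement of [U] together with an open set, and for
    [t <= 0] it is empty. Functions on [Y] extended by 0 are thus measurable on the whole space. *)
Lemma measurable_usc0 (U : set V) (f : V -> R) : eopen U ->
  usc_on U (EFin \o f) -> (forall x, 0 <= f x) -> (forall x, ~ U x -> f x = 0) ->
  measurable_fun setT f.
Proof.
move=> oU uf f0 fU; apply: measurable_funR_lt => t.
have [t0|t0] := ltP 0 t; last first.
  rewrite (_ : mkset _ = set0) //; apply/seteqP; split => x //= xt.
  by have := f0 x; lra.
rewrite (_ : mkset _ = ~` U `|` (U `&` [set x | f x < t])); last first.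
  apply/seteqP; split => x /=; last by case=> [/fU ->|[]].
  by move=> xt; have [Ux|Ux] := pselect (U x); [right|left].
apply: measurableU; first by apply: measurableC; exact: eopen_measurable.
apply: eopen_measurable => x [Ux /= xt].
have [|r r0 hr] := uf x Ux t; first by rewrite lte_fin.
have [r' r'0 hr'] := oU x Ux.
exists (Num.min r r'); first by rewrite lt_min r0.
move=> y /oballE; rewrite !lt_min r0 r'0 => /(_ isT) /andP[h1 h2].
have Uy : U y by apply: hr'; apply/oballE.
by split => //=; have := hr y Uy; rewrite lte_fin; apply; apply/oballE.
Qed.

End Measurability.

(** * Lebesgue measure on R^d *)

Section Boxes.
Variables (R : realType) (d : nat).
Local Notation V := (d.-tuple R).
Implicit Types (x y z a b : V) (r s t : R).

Definition box a b : set V := [set x | forall i, tnth a i <= tnth x i <= tnth b i].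
Definition boxes : set (set V) := [set A | exists a b, A = box a b].

Lemma measurable_box a b : measurable (box a b).
Proof.
rewrite (_ : box a b = \bigcap_(i in [set: 'I_d])
   ((fun x => tnth x i) @^-1` `[tnth a i, tnth b i])).
  apply: fin_bigcap_measurable => [|i _]; first exact: finite_finset.
  rewrite -[X in measurable X]setTI; exact: measurable_tnth.
by apply/seteqP; split => x /= h i; have := h i; rewrite /= in_itv /=; auto.
Qed.

Definition cstV t : V := [tuple t | _ < d].

Lemma boxes_cover : \bigcup_k box (cstV (- k%:R)) (cstV k%:R) = setT.
Proof.
apply/seteqP; split => // x _.
pose M := \sum_(i < d) `|tnth x i|.
exists (Num.truncn M).+1 => // i; rewrite !tnth_mktuple -ler_norml.
apply: (@le_trans _ _ M); last exact/ltW/truncnS_gt.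
by rewrite /M (bigD1 i) //= lerDl sumr_ge0.
Qed.

Lemma boxesI : setI_closed boxes.
Proof.
move=> _ _ [a [b ->]] [a' [b' ->]].
exists [tuple Num.max (tnth a i) (tnth a' i) | i < d],
  [tuple Num.min (tnth b i) (tnth b' i) | i < d].
apply/seteqP; split => x /=.
  move=> [h h'] i; rewrite !tnth_mktuple ge_max le_min.
  by have /andP[-> ->] := h i; have /andP[-> ->] := h' i.
move=> h; split => i; have := h i; rewrite !tnth_mktuple ge_max le_min;
  by move=> /andP[/andP[? ?] /andP[? ?]]; apply/andP.
Qed.

(** The preimage of a half-line starting at [t] under coordinate [i] is the union over [k] of boxes
    with side [[t, k]] in direction [i] and [[-k, k]] in the others. Hence values on boxes, all that
    [is_lebesgue] prescribes, determine the measure. *)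
Lemma measurable_boxesE : @measurable _ V = <<s boxes>>.
Proof.
apply/seteqP; split; last first.
  apply: smallest_sub; first exact: sigma_algebra_measurable.
  by move=> _ [a [b ->]]; exact: measurable_box.
apply: smallest_sub; first exact: smallest_sigma_algebra.
have key (i : 'I_d) : measurable_fun setT
    ((fun x => tnth x i) : g_sigma_algebraType boxes -> R).
  apply: (measurability _ (RGenCInfty.measurableE R)).
  move=> _ [_ [t ->] <-]; rewrite setTI.
  rewrite (_ : _ @^-1` _ = \bigcup_k box
     [tuple if j == i then t else - k%:R | j < d] (cstV k%:R)).
    apply: bigcupT_measurable => k; apply: sub_sigma_algebra; by do 2 eexists.
  apply/seteqP; split => x /=; last first.
    move=> [k _ /(_ i)]; rewrite !tnth_mktuple eqxx in_itv /= andbT.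
    by move=> /andP[].
  rewrite in_itv /= andbT => tx.
  have : [set: V] x by [].
  rewrite -boxes_cover => -[k _ hk]; exists k => // j.
  by have := hk j; rewrite !tnth_mktuple; case: eqP => // ->; rewrite tx => /andP[].
rewrite -bigcup_seq; apply: bigcup_sub => i _ A [B mB <-].
exact: key.
Qed.

End Boxes.

Section LebesgueAffine.
Variables (R : realType) (d : nat).
Local Notation V := (d.-tuple R).
Implicit Types (x y z a b : V) (r s t : R).
Variable leb : {measure set V -> \bar R}.
Hypothesis hleb : is_lebesgue leb.

Lemma measurable_vaff1 a s : measurable_fun setT (vaff a s).
Proof. exact: measurable_vaff. Qed.

Lemma leb_box_fin a b : (leb (box a b) < +oo)%E.
Proof.
have [h|] := pselect (forall i, tnth a i <= tnth b i).
  by rewrite hleb // ltry.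
move=> h; rewrite (_ : box a b = set0) ?measure0 //.
apply/seteqP; split => x //= hx; apply: h => i.
by have /andP[] := hx i; exact: le_trans.
Qed.

(** Both sides are measures in [A] that agree on boxes by direct computation; boxes form a
    generating pi-system with a cover of finite measure, so uniqueness of measures concludes. *)
Lemma leb_vaff a s (A : set V) : 0 < s -> measurable A ->
  leb (vaff a s @^-1` A) = ((s^-1 ^+ d)%:E * leb A)%E.
Proof.
move=> s0 mA.
have si : 0 <= s^-1 ^+ d by rewrite exprn_ge0 // invr_ge0 ltW.
pose p : {measure set V -> \bar R} := pushforward leb (vaff a s).
pose m1 := p (measurable_vaff1 a s).
pose m2 : {measure set V -> \bar R} := mscale (NngNum si) leb.
have H : forall b c, m1 (box b c) = m2 (box b c).
  move=> b c; rewrite /m1 /p /m2 /= /pushforward /mscale /=.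
  pose b' := [tuple (tnth b i - tnth a i) / s | i < d].
  pose c' := [tuple (tnth c i - tnth a i) / s | i < d].
  have -> : vaff a s @^-1` box b c = box b' c'.
    apply/seteqP; split => x /= h i; have := h i; rewrite !tnth_mktuple;
    by rewrite ler_pdivrMr // ler_pdivlMr // lerBlDl lerBrDl [s * _]mulrC.
  have [h|h] := pselect (forall i, tnth b i <= tnth c i).
    rewrite !hleb //; last first.
      move=> i; rewrite !tnth_mktuple ler_pM2r ?invr_gt0 //.
      by rewrite lerD2r.
    rewrite -EFinM; congr EFin.
    rewrite -[in X in X * _](card_ord d) -prodr_const -big_split /=.
    apply: eq_bigr => i _; rewrite !tnth_mktuple -mulrBl mulrC.
    by congr (_ * _); ring.
  have E (u v : V) : ~ (forall i, tnth u i <= tnth v i) -> box u v = set0.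
    move=> k; apply/seteqP; split => x //= hx; apply: k => i.
    by have /andP[] := hx i; exact: le_trans.
  rewrite (E _ _ h) E ?measure0 ?mule0 // => k; apply: h => i.
  have := k i; rewrite !tnth_mktuple ler_pM2r ?invr_gt0 //.
  by rewrite lerD2r.
apply: (measure_unique (@boxes R d) (fun k => box (cstV d (- k%:R)) (cstV d k%:R))
   _ _ _ _ m1 m2) => //.
- exact: measurable_boxesE.
- exact: boxesI.
- by move=> k; do 2 eexists.
- exact: boxes_cover.
- by move=> _ [b [c ->]]; exact: H.
- move=> k; rewrite H; rewrite /m2 /mscale /=.
  by rewrite lte_mul_pinfty // ?leb_box_fin.
Qed.

Lemma integral_vaff a s (D : set V) (f : V -> \bar R) : 0 < s -> measurable D ->
  measurable_fun D f -> (forall x, D x -> 0 <= f x)%E ->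
  (\int[leb]_(z in vaff a s @^-1` D) f (vaff a s z) =
   (s^-1 ^+ d)%:E * \int[leb]_(x in D) f x)%E.
Proof.
move=> s0 mD mf f0.
have si : 0 <= s^-1 ^+ d by rewrite exprn_ge0 // invr_ge0 ltW.
rewrite -(@ge0_integral_pushforward _ _ _ _ _ (vaff a s) (measurable_vaff1 a s)) //; last first.
  by move=> x; rewrite inE; exact: f0.
rewrite -(ge0_integral_mscale leb mD (NngNum si)) //.
apply: eq_measure_integral => [|? A mA _]; first exact: measurable_vaff1.
by rewrite /= /mscale /= /pushforward leb_vaff.
Qed.

Lemma oball_vaff a s r : 0 < s -> 0 < r ->
  vaff a s @^-1` (oball a (s * r)) = oball (origin R d) r.
Proof.
move=> s0 r0; apply/funext => z /=; apply/propext.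
rewrite /preimage /=; apply: (iff_trans (oballE _ _ (mulr_gt0 s0 r0))).
apply: iff_trans (iff_sym (oballE _ _ r0)).
by rewrite eudist_vaffl gtr0_norm // ltr_pM2l // eudistC.
Qed.

Lemma leb_oball a r : 0 < r ->
  leb (oball a r) = ((r ^+ d)%:E * leb (oball (origin R d) 1))%E.
Proof.
move=> r0; rewrite -(@oball_vaff a r 1) // mulr1 leb_vaff //; last exact: measurable_oball.
by rewrite muleA -EFinM -exprMn divff ?gt_eqF // expr1n mul1e.
Qed.

Lemma leb_bounded (A : set V) : measurable A -> ebounded A -> (leb A < +oo)%E.
Proof.
move=> mA [M hM].
apply: (@le_lt_trans _ _ (leb (box (cstV d (- M)) (cstV d M)))); last exact: leb_box_fin.
apply: le_measure; rewrite ?inE //; first exact: measurable_box.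
move=> x Ax i; rewrite !tnth_mktuple -ler_norml.
have := coord_le_eudist x (origin R d) i; rewrite tnth_origin subr0 => h.
by apply: (le_trans h); exact: hM.
Qed.

Lemma ebounded_oball a r : 0 < r -> ebounded (oball a r).
Proof.
move=> r0; exists (enorm a + r) => x /oballE - /(_ r0) h.
have := eudist_triangle x a (origin R d); rewrite -!enormE => h'.
by apply: (le_trans h'); rewrite addrC lerD2l eudistC ltW.
Qed.

Lemma leb_oball_fin a r : 0 < r -> (leb (oball a r) < +oo)%E.
Proof.
by move=> r0; apply: leb_bounded; [exact: measurable_oball|exact: ebounded_oball].
Qed.

Lemma leb_oball_gt0 a r : 0 < r -> (0 < leb (oball a r))%E.
Proof.
(* The cube of side [e] with corner [a] stays within distance [r / 2] of [a], by
   [eudist_lt_coord]. *)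
move=> r0; pose e := r / 2 / d.+1%:R.
have e0 : 0 < e by rewrite !divr_gt0.
pose b := [tuple tnth a i + e | i < d].
apply: (@lt_le_trans _ _ (leb (box a b))).
  rewrite hleb; last by move=> i; rewrite tnth_mktuple lerDl ltW.
  by rewrite lte_fin; apply: prodr_gt0 => i _; rewrite tnth_mktuple addrAC subrr add0r.
apply: le_measure; rewrite ?inE; [exact: measurable_box|exact: measurable_oball|].
move=> x hx; apply/oballE => //.
apply: (@lt_trans _ _ (r / 2)); last by rewrite ltr_pdivrMr // ltr_pMr // ltr1n.
apply: eudist_lt_coord; first by rewrite divr_gt0.
move=> i; have := hx i; rewrite tnth_mktuple -/e => /andP[h1 h2].
by rewrite distrC ger0_norm ?subr_ge0 // lerBlDl.
Qed.

Definition bvol : R := fine (leb (oball (origin R d) 1)).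

Lemma bvolE : leb (oball (origin R d) 1) = bvol%:E.
Proof. by rewrite fineK // ge0_fin_numE // leb_oball_fin. Qed.

Lemma bvol_gt0 : 0 < bvol.
Proof. by have := leb_oball_gt0 (origin R d) (ltr01 : 0 < 1 :> R); rewrite bvolE lte_fin. Qed.

Lemma leb_oballE a r : 0 < r -> leb (oball a r) = (r ^+ d * bvol)%:E.
Proof. by move=> r0; rewrite leb_oball // bvolE EFinM. Qed.

End LebesgueAffine.

(** Domination is available only on subsets of [D], so both measures are first restricted to [D]. *)
Lemma measure_le_integral dT (T : measurableType dT) (R : realType)
  (m1 m2 : {measure set T -> \bar R}) (D : set T) (f : T -> \bar R) :
  measurable D -> (forall A, measurable A -> A `<=` D -> (m1 A <= m2 A)%E) ->
  (forall x, (0 <= f x)%E) -> measurable_fun setT f ->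
  (\int[m1]_(x in D) f x <= \int[m2]_(x in D) f x)%E.
Proof.
move=> mD h f0 mf.
have E (m : {measure set T -> \bar R}) :
    (\int[m]_(x in D) f x = \int[mrestr m mD]_(x in D) f x)%E.
  by apply: eq_measure_integral => A mA AD; rewrite /= /mrestr setIidl.
rewrite (E m1) (E m2); apply: ge0_le_measure_integral => // A mA.
by rewrite /= /mrestr; apply: h; [exact: measurableI|exact: subIsetr].
Qed.

(** * Convergence theorems and compactness of balls *)

Section BoundedConvergence.
Context dT (T : measurableType dT) (R : realType).
Variables (mu : {measure set T -> \bar R}) (D : set T).
Hypotheses (mD : measurable D) (muD : (mu D < +oo)%E).

Lemma integrable_abs_bounded (f : T -> \bar R) (C : R) : measurable_fun D f ->
  (forall x, D x -> `|f x| <= C%:E)%E -> mu.-integrable D f.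
Proof.
move=> mf fC; apply/integrableP; split => //.
apply: (@le_lt_trans _ _ (\int[mu]_(x in D) (Num.max 0 C)%:E)%E).
  apply: ge0_le_integral => //; first by apply: measurableT_comp.
  by move=> x Dx; rewrite (le_trans (fC x Dx)) // lee_fin le_max lexx orbT.
by rewrite integral_cst // lte_mul_pinfty // lee_fin le_max lexx.
Qed.

Lemma integrable_bounded (f : T -> \bar R) (C : R) : measurable_fun D f ->
  (forall x, D x -> 0 <= f x <= C%:E)%E -> mu.-integrable D f.
Proof.
move=> mf f0C; apply: (@integrable_abs_bounded _ C) => // x Dx.
by have /andP[f0 fC] := f0C x Dx; rewrite gee0_abs.
Qed.

Lemma bounded_convergence (f_ : nat -> T -> \bar R) (f : T -> \bar R) (C : R) :
  (forall n, measurable_fun D (f_ n)) ->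
  (forall n x, D x -> 0 <= f_ n x <= C%:E)%E ->
  (forall x, D x -> f_ ^~ x @ \oo --> f x) ->
  (fun n => \int[mu]_(x in D) f_ n x)%E @ \oo --> (\int[mu]_(x in D) f x)%E.
Proof.
move=> mf_ f0C f_f.
have mf : measurable_fun D f by exact: (emeasurable_fun_cvg f_).
have ic : mu.-integrable D (fun=> (Num.max 0 C)%:E).
  by apply: (@integrable_bounded _ (Num.max 0 C)) => // x Dx; rewrite !lee_fin lexx le_max lexx.
have [] // := dominated_convergence mD mf_ mf (aeW _ f_f) ic.
apply: aeW => x n Dx; have /andP[f0 fC] := f0C n x Dx.
by rewrite gee0_abs // (le_trans fC) // lee_fin le_max lexx orbT.
Qed.

(** The tail suprema [s n] dominate [f_ n], are bounded by [C] and converge to the upper limit,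
    which is at most [g]; bounded convergence does the rest. The comparison of the upper limit with
    [g] is phrased by thresholds because [jlimsup_lt] and [Q2_limsup] deliver it so. *)
Lemma reverse_fatou (f_ : nat -> T -> \bar R) (g : T -> \bar R) (C : R) (a : \bar R) :
  (forall n, measurable_fun D (f_ n)) -> measurable_fun D g ->
  (forall n x, D x -> 0 <= f_ n x <= C%:E)%E ->
  (forall x, D x -> forall t : R, (g x < t%:E)%E ->
     exists N, forall n, (N <= n)%N -> (f_ n x <= t%:E)%E) ->
  (forall n, a <= \int[mu]_(x in D) f_ n x)%E ->
  (a <= \int[mu]_(x in D) g x)%E.
Proof.
move=> mf_ mg f0C lim_g af.
pose s n x := esups (f_ ^~ x) n.
have fs n x : (f_ n x <= s n x)%E by apply: ereal_sup_ubound; exists n => //=.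
have s0C n x : D x -> (0 <= s n x <= C%:E)%E.
  move=> Dx; apply/andP; split.
    by apply: le_trans (fs n x); have /andP[] := f0C n x Dx.
  by apply: ge_ereal_sup => _ [k _ <-]; have /andP[] := f0C k x Dx.
have ms n : measurable_fun D (s n) by exact: measurable_fun_esups.
pose l x := limn_esup (f_ ^~ x).
have sl x : D x -> s ^~ x @ \oo --> l x.
  by move=> _; rewrite /l limn_esup_lim; exact: is_cvg_esups.
have ls n x : (l x <= s n x)%E.
  rewrite /l limn_esup_lim; apply: lime_le; first exact: is_cvg_esups.
  by near=> m; apply: nonincreasing_esups; near: m; exists n.
have l0 x : D x -> (0 <= l x)%E.
  move=> Dx; rewrite /l limn_esup_lim; apply: lime_ge; first exact: is_cvg_esups.
  by apply: nearW => n; have /andP[] := s0C n x Dx.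
have lg x : D x -> (l x <= g x)%E.
  move=> Dx; have g0 t : (g x < t%:E)%E -> (l x <= t%:E)%E.
    move=> /(lim_g x Dx) [N hN]; apply: le_trans (ls N x) _.
    by apply: ge_ereal_sup => _ [k /= Nk <-]; exact: hN.
  case: (g x) g0 => [r||] h; last 2 first.
  - exact: leey.
  (* If [g x] were [-oo], the nonnegative [l x] would be at most -1. *)
  - by have := le_trans (l0 x Dx) (h (- 1) (ltNyr _)); rewrite lee_fin ler0N1.
  - apply/lee_addgt0Pr => e e0; rewrite -EFinD; apply: h.
    by rewrite lte_fin ltrDl.
have ml : measurable_fun D l by exact: (emeasurable_fun_cvg s).
apply: (@le_trans _ _ (\int[mu]_(x in D) l x)%E); last first.
  by apply: ge0_le_integral.
apply: (cvge_ge _ (bounded_convergence ms s0C sl)).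
apply: nearW => n; apply: le_trans (af n) _.
apply: ge0_le_integral => // x Dx.
by have /andP[] := f0C n x Dx.
Unshelve. all: by end_near. Qed.

End BoundedConvergence.

Section CompactBall.
Variables (R : realType) (d : nat).
Local Notation V := (d.-tuple R).
Implicit Types (x y z a b : V) (r s t : R).

(** Otherwise points of the closed ball whose balls of radius [n.+1%:R^-1] leave [U] accumulate at
    some [P] of the closed ball, and a ball around [P] inside [U] swallows them. Compactness comes
    from products of segments, after copying the points into row vectors. *)
Lemma cball_margin a r (U : set V) : eopen U -> cball a r `<=` U -> 0 <= r ->
  exists2 e, 0 < e & forall x, cball a r x -> oball x e `<=` U.
Proof.
move=> oU aU r0; apply: contrapT => /forall2NP nh.
have {nh} hx (n : nat) : exists x, cball a r x /\ ~ (oball x n.+1%:R^-1 `<=` U).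
  have [//|/existsNP[x]] := nh n.+1%:R^-1.
  by move/not_implyP => h; exists x.
have {hx} [u hu] := choice hx.
pose v n : 'rV[R]_d := \row_i tnth (u n) i.
pose K := [set w : 'rV[R]_d | forall i, `[tnth a i - r, tnth a i + r]%classic (w ord0 i)].
have cK : compact K.
  by apply: (rV_compact (A := fun i => `[tnth a i - r, tnth a i + r]%classic)) => i;
    exact: segment_compact.
have [p [_ clp]] : K `&` cluster (v @ \oo) !=set0.
  apply: cK; exists 0%N => // n _ i /=; rewrite in_itv /= mxE.
  have /cballE - /(_ r0) h := (hu n).1.
  have := le_trans (coord_le_eudist a (u n) i) h.
  by rewrite ler_norml => /andP[? ?]; apply/andP; split; lra.
pose P : V := [tuple p ord0 i | i < d].
have near_P e N : 0 < e -> exists2 n, (N <= n)%N & eudist (u n) P < e.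
  move=> e0; have e1 : 0 < e / d.+1%:R by rewrite divr_gt0.
  have [|_ [[n Nn <-] hn]] := clp [set w | exists2 n, (N <= n)%N & v n = w]
      (ball p (e / d.+1%:R)) _ (nbhsx_ballx _ _ e1).
    by exists N => // n Nn /=; exists n.
  exists n => //; apply: eudist_lt_coord => // i; rewrite tnth_mktuple.
  have [_ h] := hn.
  by have := h ord0 i; rewrite mxE distrC => /ltW.
have UP : U P.
  apply: aU; apply/cballE => //; apply/ler_addgt0Pr => e e0.
  have [n _ hn] := near_P e 0%N e0.
  apply: le_trans (eudist_triangle a (u n) P) _.
  apply: lerD (ltW hn); exact/cballE/(hu n).1.
have [e e0 he] := oU P UP.
have e2 : 0 < e / 2 by rewrite divr_gt0.
have [N hN] := natSinv_lt e2.
have [n Nn hn] := near_P _ N e2.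
apply: (hu n).2 => y /oballE - /(_ (ltac:(by rewrite invr_gt0))) uy.
apply: he; apply/oballE => //.
apply: le_lt_trans (eudist_triangle P (u n) y) _.
by rewrite (splitr e) ltrD // ?(lt_trans uy (hN n Nn)) // eudistC.
Qed.

End CompactBall.

(** * From spherical means to ball means *)

Section BallMean.
Variables (R : realType) (d : nat).
Hypothesis hd : (0 < d)%N.
Local Notation V := (d.-tuple R).
Implicit Types (x y z a b : V) (r s t : R).
Variable leb : {measure set V -> \bar R}.
Hypothesis hleb : is_lebesgue leb.

Local Notation B := (oball (origin R d)).

(** The radius 0 is included for the sake of the innermost annulus in [ball_mean_le]. *)
Lemma oballP a r y : 0 <= r -> oball a r y <-> eudist a y < r.
Proof.
rewrite le_eqVlt => /predU1P[<-|/oballE]; last exact.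
rewrite /oball /= expr0n /=; split => h; exfalso.
  by have := sqdist_ge0 a y; rewrite leNgt h.
by have := eudist_ge0 a y; rewrite leNgt h.
Qed.

Lemma sub_mean_ge (f : V -> R) a r :
  ((f a)%:E <= sphere_mean leb (EFin \o f) a r)%E <->
  ((bvol leb * f a)%:E <= \int[leb]_(z in B 1) (f (sph_point a r z))%:E)%E.
Proof.
rewrite /sphere_mean -/(bvol leb).
have b0 := bvol_gt0 hleb.
by rewrite lee_pdivlMl // EFinM.
Qed.

(** The integrand depends only on the direction of [z], so a dilation changes nothing but the
    volume. *)
Lemma ge0_integral_oball_sph (f : V -> R) a r s : 0 < s -> measurable_fun setT f ->
  (forall x, 0 <= f x) ->
  (\int[leb]_(z in B s) (f (sph_point a r z))%:E =
   (s ^+ d)%:E * \int[leb]_(z in B 1) (f (sph_point a r z))%:E)%E.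
Proof.
move=> s0 mf f0.
have mg : measurable_fun setT (fun z => (f (sph_point a r z))%:E).
  apply/measurable_EFinP; apply: measurableT_comp => //.
  exact: measurable_sph_point.
have := integral_vaff hleb (origin R d) s0 (measurable_oball (origin R d) s)
  (measurable_funTS mg) (fun x _ => f0 _).
have := oball_vaff (origin R d) s0 (ltr01 : 0 < 1 :> R); rewrite mulr1 => -> h.
rewrite (_ : (\int[leb]_(z in B 1) _ =
   \int[leb]_(z in B 1) (f (sph_point a r (vaff (origin R d) s z)))%:E)%E); last first.
  by apply: eq_integral => z _; rewrite sph_point_scale.
by rewrite h muleA -EFinM -exprMn divff ?gt_eqF // expr1n mul1e.
Qed.

(* Radial rounding at scale 1/N turns the integral over a ball into a Riemann sum of
   spherical means over the annuli k/N <= |z| < (k+1)/N. *)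
Lemma ball_mean_le (f : V -> R) (M : R) a r : 0 < r ->
  measurable_fun setT f -> (forall x, 0 <= f x <= M) ->
  (forall x, eudist a x <= r -> forall e, 0 < e -> exists2 del : R, 0 < del &
     forall y, eudist a y <= r -> eudist x y < del -> `|f x - f y| < e) ->
  (forall s, 0 < s <= r -> ((f a)%:E <= sphere_mean leb (EFin \o f) a s)%E) ->
  ((r ^+ d * bvol leb * f a)%:E <= \int[leb]_(x in oball a r) (f x)%:E)%E.
Proof.
move=> r0 mf f0M cf mean.
have f0 x : 0 <= f x by have /andP[] := f0M x.
have d0 : d == 0%N = false by case: (d) hd.
(* Rounding up keeps the radius positive, as the spherical inequality requires, and at most [r] as
   long as [t < 1]. *)
pose rd N t : R := r * ((Num.truncn (N.+1%:R * t)).+1%:R / N.+1%:R).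
pose T N z := vaff a (rd N (enorm z) * (enorm z `^ (-1))) z.
have TE N z : T N z = sph_point a (rd N (enorm z)) z.
  by rewrite /T powR_inv1 ?sph_pointE // eudist_ge0.
have mrd N : measurable_fun setT (rd N).
  apply: nondecreasing_measurable => // u v uv; rewrite /rd ler_pM2l // ler_pM2r ?invr_gt0 //.
  by rewrite ler_nat ltnS le_truncn // ler_pM2l.
have mT N : measurable_fun setT (T N).
  apply: measurable_vaff => //; apply: measurable_funM.
    by apply: (measurableT_comp (mrd N)); exact: measurable_enorm.
  by apply: (measurableT_comp (measurable_powR _)); exact: measurable_enorm.
have mfT N : measurable_fun setT (fun z => (f (T N z))%:E).
  by apply/measurable_EFinP; exact: measurableT_comp.
(* Induction over annuli: on the annulus added at step [k], [T N] maps to the sphere of radius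
   [r * (k.+1%:R / N.+1%:R)], so the integral there is a volume increment times a spherical
   integral, to which [mean] applies. *)
have step N k : (k <= N.+1)%N ->
    (((k%:R / N.+1%:R) ^+ d * (bvol leb * f a))%:E <=
     \int[leb]_(z in B (k%:R / N.+1%:R)) (f (T N z))%:E)%E.
  elim: k => [_|k IH kN].
    by rewrite mul0r expr0n d0 mul0r; apply: integral_ge0 => z _; rewrite lee_fin.
  have Np : 0 < N.+1%:R :> R by [].
  pose A := B (k.+1%:R / N.+1%:R) `\` B (k%:R / N.+1%:R).
  have k1 : 0 < k.+1%:R / N.+1%:R :> R by rewrite divr_gt0.
  have k0 : 0 <= k%:R / N.+1%:R :> R by rewrite divr_ge0.
  have sub : B (k%:R / N.+1%:R) `<=` B (k.+1%:R / N.+1%:R).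
    move=> z /(oballP _ _ k0) hz; apply/(oballE _ _ k1); apply: lt_trans hz _.
    by rewrite ltr_pM2r ?invr_gt0 // ltr_nat.
  have mB s : measurable (B s) by exact: measurable_oball.
  have mA : measurable A by exact: measurableD.
  have BA : B (k.+1%:R / N.+1%:R) = B (k%:R / N.+1%:R) `|` A.
    by rewrite /A setDUK.
  have dis : [disjoint B (k%:R / N.+1%:R) & A].
    by rewrite /A disj_set_sym; apply/disj_setPS => z [[]].
  rewrite BA ge0_integral_setU //; last 2 first.
  - exact: measurable_funTS.
  - by move=> z _; rewrite lee_fin.
  pose g z := (f (sph_point a (r * (k.+1%:R / N.+1%:R)) z))%:E.
  have mg : measurable_fun setT g.
    apply/measurable_EFinP; apply: measurableT_comp => //; exact: measurable_sph_point.
  have -> : (\int[leb]_(z in A) (f (T N z))%:E = \int[leb]_(z in A) g z)%E.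
    apply: eq_integral => z; rewrite inE => -[/(oballE _ _ k1) h1 h2].
    have {}h2 : k%:R / N.+1%:R <= enorm z.
      rewrite leNgt; apply/negP => h; apply: h2; apply/(oballP _ _ k0).
      by rewrite eudistC.
    rewrite eudistC -enormE in h1.
    rewrite /g TE /rd (_ : Num.truncn _ = k) //; apply: truncn_def.
    by rewrite [_ * enorm z]mulrC -ler_pdivrMr // -ltr_pdivlMr // h2.
  have g0 z : (0 <= g z)%E by rewrite /g lee_fin.
  have gE s : 0 < s -> (\int[leb]_(z in B s) g z =
     (s ^+ d)%:E * \int[leb]_(z in B 1) g z)%E.
    by move=> s0; exact: ge0_integral_oball_sph.
  have gM : (\int[leb]_(z in B 1) g z)%E \is a fin_num.
    rewrite ge0_fin_numE; last by exact: integral_ge0.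
    have /integrableP[_] : leb.-integrable (B 1) g.
      apply: (@integrable_bounded _ _ _ _ _ (mB 1) (leb_oball_fin hleb _ ltr01) g M).
      - exact: measurable_funTS.
      - by move=> z _; rewrite g0 lee_fin; have /andP[] := f0M (sph_point a (r * (k.+1%:R / N.+1%:R)) z).
    apply: le_lt_trans; rewrite le_eqVlt; apply/orP; left; apply/eqP.
    by apply: eq_integral => z _; rewrite gee0_abs.
  have gle : ((bvol leb * f a)%:E <= \int[leb]_(z in B 1) g z)%E.
    apply: (proj1 (sub_mean_ge f a _)); apply: mean.
    rewrite mulr_gt0 //= ler_piMr ?(ltW r0) // ler_pdivrMr // mul1r ler_nat //.
  have gA : (\int[leb]_(z in A) g z =
     ((k.+1%:R / N.+1%:R) ^+ d - (k%:R / N.+1%:R) ^+ d)%:E * \int[leb]_(z in B 1) g z)%E.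
    have := gE _ k1; rewrite {1}BA ge0_integral_setU //; last first.
      exact: measurable_funTS.
    have -> : (\int[leb]_(z in B (k%:R / N.+1%:R)) g z =
        ((k%:R / N.+1%:R) ^+ d)%:E * \int[leb]_(z in B 1) g z)%E.
      (* For [k = 0] the inner ball is empty and [0 ^+ d = 0] because [0 < d]. *)
      have [k00|] := eqVneq k 0%N; last by rewrite -lt0n => kp; apply: gE; rewrite divr_gt0 ?ltr0n.
      rewrite k00 mul0r expr0n d0 mul0e (_ : B 0 = set0) ?integral_set0 //.
      apply/seteqP; split => z // /oballP - /(_ (lexx _)).
      by rewrite ltNge eudist_ge0.
    move: gM => /fineK <-; set I := fine _ => h.
    have : (\int[leb]_(z in A) g z = ((k.+1%:R / N.+1%:R) ^+ d)%:E * I%:E -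
        ((k%:R / N.+1%:R) ^+ d)%:E * I%:E)%E.
      by rewrite -h addeAC subee ?add0e // -EFinM.
    by move=> ->; rewrite -!EFinM -EFinB mulrBl.
  have -> : (k.+1%:R / N.+1%:R) ^+ d * (bvol leb * f a) =
     (k%:R / N.+1%:R) ^+ d * (bvol leb * f a) +
     ((k.+1%:R / N.+1%:R) ^+ d - (k%:R / N.+1%:R) ^+ d) * (bvol leb * f a).
    by rewrite -mulrDl addrC subrK.
  rewrite EFinD; apply: leeD; first by apply: IH; exact: ltnW.
  rewrite gA EFinM; apply: lee_wpmul2l => //.
  rewrite lee_fin subr_ge0 lerXn2r ?nnegrE ?(ltW k1) //.
  by rewrite ler_pM2r ?invr_gt0 // ler_nat.
have cvT : (fun N => \int[leb]_(z in B 1) (f (T N z))%:E)%E @ \oo -->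
    (\int[leb]_(z in B 1) (f (vaff a r z))%:E)%E.
  apply: (@bounded_convergence _ _ _ _ _ (measurable_oball _ 1)
    (leb_oball_fin hleb _ ltr01) _ _ M).
  - by move=> N; exact: measurable_funTS.
  - by move=> N z _; rewrite !lee_fin.
  - move=> z /(oballE _ _ ltr01); rewrite eudistC -enormE => z1.
    (* Rounding moves the radius by at most [r / N.+1%:R], so continuity on the closed ball gives
       pointwise convergence. *)
    have dT N : eudist (vaff a r z) (T N z) <= r / N.+1%:R.
      rewrite /T eudist_vaff.
      have [->|z0] := eqVneq (enorm z) 0.
        by rewrite mulr0 divr_ge0 // ltW.
      have zp : 0 < enorm z by rewrite lt_def z0 eudist_ge0.
      have Np : 0 < N.+1%:R :> R by [].
      rewrite powR_inv1 ?(ltW zp) // -[X in _ * X](gtr0_norm zp) -normrM mulrBl divfK //.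
      have /andP[h1 h2] := truncn_itv (mulr_ge0 (ltW Np) (ltW zp)).
      rewrite /rd; set k := Num.truncn _ in h1 h2 *.
      rewrite -mulrBr normrM (gtr0_norm r0) ler_pM2l //.
      rewrite distrC ger0_norm ?subr_ge0; last first.
        by rewrite ler_pdivlMr // mulrC ltW.
      rewrite lerBlDr ler_pdivrMr // mulrDl mulVf ?gt_eqF //.
      by rewrite -natr1 addrC lerD2l mulrC.
    have inB N : eudist a (T N z) <= r.
      rewrite TE; apply: le_trans (eudist_sph_point _ _ _) _.
        by rewrite mulr_ge0 ?divr_ge0 // ltW.
      rewrite /rd ler_piMr ?(ltW r0) // ler_pdivrMr // mul1r ler_nat.
      rewrite truncn_lt_nat ?mulr_ge0 ?eudist_ge0 //.
      by rewrite -[ltRHS]mulr1 ltr_pM2l.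
    have inB' : eudist a (vaff a r z) <= r.
      by rewrite eudist_vaffl gtr0_norm // ler_piMr ?(ltW r0) // ltW.
    apply: cvg_EFin; first by apply: nearW.
    apply/cvgrPdist_lt => e e0.
    have [del del0 hdel] := cf _ inB' _ e0.
    have [N0 hN0] := natSinv_lt (divr_gt0 del0 r0).
    exists N0 => // N /= hN; apply: hdel; first exact: inB.
    apply: le_lt_trans (dT N) _.
    by rewrite mulrC -ltr_pdivlMr //; exact: hN0.
have lim1 : ((bvol leb * f a)%:E <= \int[leb]_(z in B 1) (f (vaff a r z))%:E)%E.
  apply: (cvge_ge _ cvT); apply: nearW => N.
  by have := step N N.+1 (leqnn _); rewrite divff ?expr1n ?mul1r.
have := integral_vaff hleb a r0 (measurable_oball a r) (f := EFin \o f)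
  (measurable_funTS _) (fun x _ => f0 x).
have := oball_vaff a r0 (ltr01 : 0 < 1 :> R); rewrite mulr1 => -> h.
rewrite {}h in lim1; last by apply/measurable_EFinP.
by rewrite -mulrA EFinM -lee_pdivlMl ?exprn_gt0 // -exprVn.
Qed.

End BallMean.

Lemma bernoulli (R : realDomainType) (s : R) n : 0 <= s <= 1 ->
  1 - n%:R * (1 - s) <= s ^+ n.
Proof.
move=> /andP[s0 s1]; elim: n => [|n IH]; first by rewrite mul0r subr0 expr0.
rewrite exprS; have h := ler_wpM2l s0 IH; apply: le_trans h.
rewrite -subr_ge0 -natr1.
rewrite (_ : _ - _ = n%:R * (1 - s) ^+ 2); first by rewrite mulr_ge0 ?sqr_ge0.
by ring.
Qed.

(** This lets [s] tend to 1. At [s = 1 - e / D], Bernoulli's inequality loses at most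
    [e * (Q * n%:R / D)], and [D] is chosen larger than both [Q * n%:R] and [e]. *)
Lemma le_of_expr_le (R : realFieldType) (Q L : R) n : 0 <= Q ->
  (forall s, 0 < s < 1 -> s ^+ n * Q <= L) -> Q <= L.
Proof.
move=> Q0 h; apply/ler_addgt0Pr => e e0.
pose D : R := Q * n%:R + e + 1.
have D0 : 0 < D by rewrite /D ltr_wpDl // addr_ge0 ?mulr_ge0 // ltW.
have eD : 0 < e / D < 1.
  rewrite divr_gt0 //= ltr_pdivrMr // mul1r /D.
  by have : 0 <= Q * n%:R by [apply: mulr_ge0]; lra.
have s01 : 0 < 1 - e / D < 1 by apply/andP; split; lra.
have s01' : 0 <= 1 - e / D <= 1 by apply/andP; split; lra.
have := ler_wpM2r Q0 (bernoulli n s01'); rewrite subKr => h2.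
have := le_trans h2 (h _ s01).
rewrite mulrBl mul1r lerBlDr => /le_trans; apply.
rewrite lerD2l (_ : _ * _ * Q = e * ((Q * n%:R) / D)); last by ring.
rewrite ler_piMr ?(ltW e0) // ler_pdivrMr // mul1r /D.
by rewrite -addrA lerDl addr_ge0 // ltW.
Qed.

(** * Normalized subharmonic functions *)

Section Admissible.
Variables (R : realType) (d : nat).
Hypothesis hd : (0 < d)%N.
Local Notation V := (d.-tuple R).
Implicit Types (x y z a b w : V) (r s t e rho : R).
Variable leb : {measure set V -> \bar R}.
Hypothesis hleb : is_lebesgue leb.
Variable Y : set V.
Hypotheses (hYo : eopen Y) (hYb : ebounded Y).

(** Normal form of a competitor: nonnegative and extended by zero, so that it is measurable on the
    whole space and nonnegative integration applies. Values off [Y] do not affect the dual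
    functional. *)
Definition adm (h : V -> R) : Prop :=
  [/\ sh_Cb leb Y h, (forall x, 0 <= h x) & (forall x, ~ Y x -> h x = 0)].

(** For [rho > 0], the points at distance at least [rho] from the complement of [Y]; these sets play
    the part of compact subsets in all local estimates. *)
Definition inner rho : set V := [set x | oball x rho `<=` Y].

Lemma inner_sub rho : 0 < rho -> inner rho `<=` Y.
Proof. by move=> r0 x; apply; apply/oballE => //; rewrite eudistxx. Qed.

Lemma inner_shift rho s x y : 0 < s -> 0 < rho - s -> inner rho x -> eudist x y <= s ->
  inner (rho - s) y.
Proof.
move=> s0 rs hx xy z /oballE - /(_ rs) yz; apply: hx; apply/oballE.
  by rewrite -(subrK s rho) addr_gt0.
apply: le_lt_trans (eudist_triangle x y z) _.
by rewrite -(subrK s rho) addrC ltr_leD.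
Qed.

Lemma inner_half rho x y : 0 < rho -> inner rho x -> eudist x y <= rho / 2 ->
  inner (rho / 2) y.
Proof.
move=> r0 hx xy; rewrite (_ : rho / 2 = rho - rho / 2); last by field.
by apply: inner_shift hx xy; rewrite ?divr_gt0 // (_ : _ - _ = rho / 2) ?divr_gt0 //; field.
Qed.

Lemma measurable_inner rho : 0 < rho -> measurable (inner rho).
Proof.
move=> r0; rewrite -[inner rho]setCK; apply: measurableC; apply: eopen_measurable.
move=> x /existsNP[y] /not_implyP[/oballE - /(_ r0) xy nY].
exists (rho - eudist x y); first by rewrite subr_gt0.
move=> z /oballE; rewrite subr_gt0 => /(_ xy) xz; apply/existsNP; exists y.
apply/not_implyP; split => //; apply/oballE => //.
apply: le_lt_trans (eudist_triangle z x y) _.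
by rewrite -ltrBrDr eudistC.
Qed.

Lemma inner_mono r s : 0 < r -> r <= s -> inner s `<=` inner r.
Proof.
move=> r0 rs x hx y /(oballE _ _ r0) xy; apply: hx.
by apply/oballE; [exact: lt_le_trans rs|exact: lt_le_trans rs].
Qed.

Lemma mem_inner x : Y x -> exists2 r, 0 < r & inner r x.
Proof. by move=> /hYo. Qed.

Lemma cball_inner x r rho : 0 <= r -> r < rho -> inner rho x -> cball x r `<=` Y.
Proof.
move=> r0 rr hx y /(cballE _ _ r0) xy; apply: hx; apply/oballE.
  exact: le_lt_trans rr.
exact: le_lt_trans rr.
Qed.

Lemma leb_inner_fin rho : 0 < rho -> (leb (inner rho) < +oo)%E.
Proof.
move=> r0; apply: (leb_bounded hleb); first exact: measurable_inner.
by have [M hM] := hYb; exists M => x /(inner_sub r0) /hM.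
Qed.

Section OneFunction.
Variable h : V -> R.
Hypothesis ah : adm h.

Lemma adm_ge0 x : 0 <= h x. Proof. by case: ah. Qed.

Lemma adm_out x : ~ Y x -> h x = 0. Proof. by case: ah => _ _; exact. Qed.

Lemma adm_bounded : exists2 M, 0 <= M & forall x, 0 <= h x <= M.
Proof.
case: ah => [[[_ [M hM]] _] h0 hY]; exists `|M| => // x; rewrite h0 /=.
have [Yx|nYx] := pselect (Y x); last by rewrite hY.
by rewrite -[h x]ger0_norm // (le_trans (hM x Yx)) // ler_norm.
Qed.

Lemma adm_continuous x : Y x -> forall e, 0 < e -> exists2 del, 0 < del &
  forall y, eudist x y < del -> `|h x - h y| < e.
Proof.
move=> Yx e e0; case: ah => [[[/(_ x Yx e e0)[r r0 hr] _] _] _ _].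
have [s s0 hs] := hYo Yx; exists (Num.min r s); first by rewrite lt_min r0.
move=> y; rewrite lt_min => /andP[h1 h2]; apply: hr; last exact/oballE.
by apply: hs; apply/oballE.
Qed.

Lemma adm_measurable : measurable_fun setT h.
Proof.
apply: (measurable_usc0 hYo) => //; [|exact: adm_ge0|exact: adm_out].
by case: ah => [[_ [_ ? _]] _ _].
Qed.

Lemma adm_measurableE (D : set V) : measurable_fun D (EFin \o h).
Proof. by apply/measurable_EFinP; apply: measurable_funTS; exact: adm_measurable. Qed.

Lemma adm_ball_mean a r : 0 < r -> cball a r `<=` Y ->
  ((r ^+ d * bvol leb * h a)%:E <= \int[leb]_(x in oball a r) (h x)%:E)%E.
Proof.
move=> r0 aY; have [M _ hM] := adm_bounded.
apply: (ball_mean_le hd hleb r0 adm_measurable hM).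
  move=> x ax e e0; have [|del d0 hdel] := @adm_continuous x _ e e0.
    by apply: aY; apply/cballE => //; exact: ltW.
  by exists del => // y _; exact: hdel.
move=> s /andP[s0 sr]; case: ah => [[_ [_ _ H]] _ _]; apply: H => // y.
by move=> /(cballE _ _ (ltW s0)) ay; apply: aY; apply/cballE; [exact: ltW|exact: le_trans ay sr].
Qed.

End OneFunction.

Section LocalBound.
Variable nu : probability V R.
Variable c : R.
Hypothesis c0 : 0 < c.
Hypothesis hc : forall A, measurable A -> A `<=` Y -> (c%:E * leb A <= nu A)%E.

Lemma leb_le_nu (A : set V) (f : V -> R) : measurable A -> A `<=` Y ->
  measurable_fun setT f -> (forall x, 0 <= f x) ->
  (\int[leb]_(x in A) (f x)%:E <= c^-1%:E * \int[nu]_(x in A) (f x)%:E)%E.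
Proof.
move=> mA AY mf f0; rewrite lee_pdivlMl //.
have c1 : 0 <= c by exact: ltW.
have mf' : measurable_fun setT (EFin \o f) by apply/measurable_EFinP.
rewrite -(ge0_integral_mscale leb mA (NngNum c1)); last 2 first.
- exact: measurable_funTS.
- by move=> x _; rewrite lee_fin.
apply: measure_le_integral => // B mB BA.
by rewrite /= /mscale /=; apply: hc => //; exact: subset_trans AY.
Qed.

Lemma mY : measurable Y. Proof. exact: eopen_measurable. Qed.

(** Obtained from [(rho / 2) ^+ d * bvol leb * h x], at most the integral of [h] over a ball of
    radius [rho / 2], which is at most [C / c]. The half radius keeps the closed ball inside [Y]. *)
Definition locbound (C rho : R) : R := C / (c * bvol leb * (rho / 2) ^+ d).

Lemma adm_local_bound h C rho x : adm h ->
  (\int[nu]_(y in Y) (h y)%:E <= C%:E)%E -> 0 < rho -> inner rho x ->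
  h x <= locbound C rho.
Proof.
move=> ah hC r0 hx; have r2 : 0 < rho / 2 by rewrite divr_gt0.
have b0 := bvol_gt0 hleb.
have sub : oball x (rho / 2) `<=` Y.
  move=> y /(oballE _ _ r2) xy; apply: (cball_inner (ltW r2) _ hx).
    by rewrite ltr_pdivrMr // ltr_pMr // ltr1n.
  by apply/cballE; rewrite ltW.
have xY : cball x (rho / 2) `<=` Y.
  by apply: (cball_inner (ltW r2) _ hx); rewrite ltr_pdivrMr // ltr_pMr // ltr1n.
have := adm_ball_mean ah r2 xY.
have mB := measurable_oball x (rho / 2).
have := leb_le_nu mB sub (adm_measurable ah) (adm_ge0 ah).
move=> /[swap] /le_trans h1 /h1 h2.
have : (((rho / 2) ^+ d * bvol leb * h x)%:E <= c^-1%:E * C%:E)%E.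
  apply: (le_trans h2); apply: lee_wpmul2l; first by rewrite lee_fin invr_ge0 ltW.
  apply: le_trans hC; apply: ge0_subset_integral => //; first exact: mY.
    exact: (adm_measurableE ah).
  by move=> y _; rewrite lee_fin; exact: (adm_ge0 ah).
rewrite -EFinM lee_fin ler_pdivlMl // => h3.
rewrite /locbound ler_pdivlMr ?mulr_gt0 ?exprn_gt0 //.
by apply: le_trans h3; rewrite le_eqVlt; apply/orP; left; apply/eqP; ring.
Qed.

End LocalBound.

End Admissible.

Lemma vaff1C (R : realType) (d : nat) (x w : d.-tuple R) : vaff x 1 w = vaff w 1 x.
Proof. by apply: eq_from_tnth => i; rewrite !tnth_vaff; ring. Qed.

(** * The joint limit superior *)

Section LebesgueTonelli.
Variables (R : realType) (d : nat).
Local Notation V := (d.-tuple R).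
Variable leb : {measure set V -> \bar R}.
Hypothesis hleb : is_lebesgue leb.

Lemma sigma_finite_leb : sigma_finite setT leb.
Proof.
exists (fun k => box (cstV d (- k%:R)) (cstV d k%:R)).
  by apply/esym; exact: boxes_cover.
by move=> k; split; [exact: measurable_box|exact: leb_box_fin].
Qed.

(** Tonelli's theorem concerns sigma-finite measures and whole spaces: a copy of [leb] receives that
    structure, and [F] is extended by 0 outside [A] times [B]. *)
Let lebf : set V -> \bar R := leb.
HB.instance Definition _ := Measure.on lebf.
HB.instance Definition _ := Measure_isSigmaFinite.Build _ V R lebf sigma_finite_leb.
Let lebs : {sigma_finite_measure set V -> \bar R} := lebf.

Variables (A B : set V) (F : V * V -> \bar R).
Hypotheses (mA : measurable A) (mB : measurable B) (mF : measurable_fun setT F).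
Hypothesis F0 : forall u, (0 <= F u)%E.

Let G := F \_ (A `*` B).

Let mG : measurable_fun setT G.
Proof.
apply: (proj1 (measurable_restrictT F (measurableX mA mB))).
exact: measurable_funTS.
Qed.

Let G0 u : (0 <= G u)%E. Proof. by rewrite /G /patch; case: ifP. Qed.

Let GE1 x : (\int[leb]_z G (x, z) = ((fun x => \int[leb]_(z in B) F (x, z)) \_ A) x)%E.
Proof.
rewrite [RHS]/patch; case: ifPn => xA.
  rewrite [RHS]integral_mkcond; apply: eq_integral => z _; rewrite /G /patch.
  by rewrite in_setX /= xA.
apply: integral0_eq => z _; rewrite /G /patch in_setX /= (negbTE xA) //.
Qed.

Let GE2 z : (\int[leb]_x G (x, z) = ((fun z => \int[leb]_(x in A) F (x, z)) \_ B) z)%E.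
Proof.
rewrite [RHS]/patch; case: ifPn => zB.
  rewrite [RHS]integral_mkcond; apply: eq_integral => x _; rewrite /G /patch.
  by rewrite in_setX /= zB andbT.
apply: integral0_eq => x _; rewrite /G /patch in_setX /= (negbTE zB) andbF //.
Qed.

Lemma leb_tonelli : (\int[leb]_(x in A) \int[leb]_(z in B) F (x, z) =
  \int[leb]_(z in B) \int[leb]_(x in A) F (x, z))%E.
Proof.
have := @fubini_tonelli _ _ _ _ _ lebs lebs G mG G0.
under eq_integral do rewrite GE1.
under [in RHS]eq_integral do rewrite GE2.
by rewrite -!integral_mkcond.
Qed.

Lemma measurable_leb_integral :
  measurable_fun A (fun x => \int[leb]_(z in B) F (x, z))%E.
Proof.
have := @measurable_fun_fubini_tonelli_F _ _ _ _ _ lebs G mG G0.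
have -> : fubini_F lebs G = (fun x => \int[leb]_(z in B) F (x, z))%E \_ A.
  by apply/funext => x; rewrite -GE1.
by move=> h; apply: (proj2 (measurable_restrictT _ mA)).
Qed.

End LebesgueTonelli.

Section JointLimsup.
Variables (R : realType) (d : nat).
Hypothesis hd : (0 < d)%N.
Local Notation V := (d.-tuple R).
Implicit Types (x y z a b w : V) (r s t e rho : R).
Variable leb : {measure set V -> \bar R}.
Hypothesis hleb : is_lebesgue leb.
Variable Y : set V.
Hypotheses (hYo : eopen Y) (hYb : ebounded Y).
Variable nu : probability V R.
Variable c : R.
Hypothesis c0 : 0 < c.
Hypothesis hc : forall A, measurable A -> A `<=` Y -> (c%:E * leb A <= nu A)%E.
Variable h_ : nat -> V -> R.
Variable C : R.
Hypothesis ah : forall n, adm leb Y (h_ n).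
Hypothesis hC : forall n, (\int[nu]_(y in Y) (h_ n y)%:E <= C%:E)%E.

Local Notation inner := (inner Y).
Local Notation K := (locbound leb c C).

Let h0 n x : 0 <= h_ n x. Proof. exact: (adm_ge0 (ah n)). Qed.
Let mh n : measurable_fun setT (h_ n). Proof. exact: (adm_measurable hYo (ah n)). Qed.

(** One [N] serves as index threshold and as radius; nothing is lost, since enlarging [N] only
    restricts the pairs [(m, y)] further. *)
Definition evub x t := exists N, forall m y, (N <= m)%N -> Y y ->
  eudist x y < N.+1%:R^-1 -> h_ m y <= t.

(* The upper limit of [h_ m y] as [m] tends to infinity and [y] tends to [x] jointly: it builds the
   upper semicontinuous regularization into the pointwise limit superior. *)
Definition jlimsup x : R := if pselect (Y x) then inf [set t | evub x t] else 0.

Local Notation p := jlimsup.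

Lemma evub_ge0 x t : Y x -> evub x t -> 0 <= t.
Proof.
move=> Yx [N hN]; apply: le_trans (h0 N x) (hN _ _ (leqnn _) Yx _).
by rewrite eudistxx invr_gt0.
Qed.

Lemma evub_locbound rho x : 0 < rho -> inner rho x -> evub x (K (rho / 2)).
Proof.
move=> r0 hx; have r2 : 0 < rho / 2 by rewrite divr_gt0.
have [N hN] := natSinv_lt r2; exists N => m y Nm Yy xy.
apply: (adm_local_bound hd hleb hYo c0 hc (ah m) (hC m) r2).
by apply: (inner_half r0 hx); apply: ltW; apply: lt_trans xy (hN _ _).
Qed.

(** This guards against the default value of [inf]: the local bound, uniform in the index, supplies
    an element, and nonnegativity a lower bound. *)
Lemma has_inf_evub x : Y x -> has_inf [set t | evub x t].
Proof.
move=> Yx; split; last by exists 0 => t; exact: evub_ge0.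
by have [r r0 hr] := mem_inner hYo Yx; exists (K (r / 2)); exact: evub_locbound.
Qed.

Lemma jlimsup_in x : Y x -> p x = inf [set t | evub x t].
Proof. by rewrite /jlimsup; case: pselect. Qed.

Lemma jlimsup_out x : ~ Y x -> p x = 0.
Proof. by rewrite /jlimsup; case: pselect. Qed.

Lemma jlimsup_le x t : Y x -> evub x t -> p x <= t.
Proof.
move=> Yx ht; rewrite jlimsup_in //; apply: ge_inf => //.
by have [] := has_inf_evub Yx.
Qed.

Lemma jlimsup_ge0 x : 0 <= p x.
Proof.
have [Yx|/jlimsup_out ->//] := pselect (Y x); rewrite jlimsup_in //.
by apply: lb_le_inf; [have [] := has_inf_evub Yx|move=> t; exact: evub_ge0].
Qed.

Lemma jlimsup_lt x t : Y x -> p x < t -> exists N, forall m y, (N <= m)%N -> Y y ->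
  eudist x y < N.+1%:R^-1 -> h_ m y < t.
Proof.
move=> Yx pt; have e0 : 0 < t - p x by rewrite subr_gt0.
have [u [N hN] ut] := inf_adherent e0 (has_inf_evub Yx).
exists N => m y Nm Yy xy; apply: le_lt_trans (hN m y Nm Yy xy) _.
by move: ut; rewrite -jlimsup_in // addrC subrK.
Qed.

Lemma jlimsup_gt x t : Y x -> t < p x -> forall N, exists m y,
  [/\ (N <= m)%N, Y y, eudist x y < N.+1%:R^-1 & t < h_ m y].
Proof.
move=> Yx tp N; apply: contrapT => nex.
suff : evub x t by move=> /(jlimsup_le Yx); rewrite leNgt tp.
exists N => m y Nm Yy xy; rewrite leNgt; apply/negP => ty; apply: nex.
by exists m, y.
Qed.

Lemma jlimsup_usc : usc_on Y (EFin \o p).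
Proof.
move=> x Yx t; rewrite lte_fin => pt.
(* An eventual bound [t1] only gives [p y <= t1], so strictness has to come from [t1 < t]. *)
have [t1 pt1 t1t] : exists2 t1, p x < t1 & t1 < t by exists ((p x + t) / 2); lra.
have [N hN] := jlimsup_lt Yx pt1.
have r0 : 0 < N.+1%:R^-1 / 2 :> R by rewrite divr_gt0 // invr_gt0.
exists (N.+1%:R^-1 / 2) => // y Yy /(oballE _ _ r0) xy.
have [N1 hN1] := natSinv_lt r0.
rewrite lte_fin; apply: le_lt_trans t1t; apply: jlimsup_le => //.
exists (maxn N N1) => m z; rewrite geq_max => /andP[Nm _] Yz yz.
apply/ltW/hN => //; apply: le_lt_trans (eudist_triangle x y z) _.
rewrite (splitr N.+1%:R^-1) ltrD // (lt_trans yz) //.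
by apply: hN1; rewrite leq_maxr.
Qed.

Lemma measurable_jlimsup : measurable_fun setT p.
Proof.
apply: (measurable_usc0 hYo jlimsup_usc) => //; [exact: jlimsup_ge0|exact: jlimsup_out].
Qed.

Lemma measurable_dist m n : measurable_fun setT (fun x => `|h_ m x - h_ n x|).
Proof. by apply: measurableT_comp => //; exact: measurable_funB. Qed.

Lemma ball_integral_fin m a r : 0 < r ->
  (\int[leb]_(x in oball a r) (h_ m x)%:E)%E \is a fin_num.
Proof.
move=> r0; have [M M0 hM] := adm_bounded (ah m).
have mB := measurable_oball a r.
have := integrable_bounded (mu := leb) mB (leb_oball_fin hleb a r0) (C := M)
  (measurable_funTS ((measurable_EFinP _ _).2 (mh m))).
move=> /(_ (fun x _ => hM x)) /integrable_fin_num; exact.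
Qed.

Lemma ball_integral_le m n a r (D : set V) : measurable D -> oball a r `<=` D ->
  (\int[leb]_(x in oball a r) (h_ m x)%:E <=
   \int[leb]_(x in oball a r) (h_ n x)%:E + \int[leb]_(x in D) `|h_ m x - h_ n x|%:E)%E.
Proof.
move=> mD aD; have mB := measurable_oball a r.
have m1 : measurable_fun setT (fun x => (`|h_ m x - h_ n x|)%:E).
  by apply/measurable_EFinP; exact: measurable_dist.
have m2 k : measurable_fun setT (fun x => (h_ k x)%:E) by apply/measurable_EFinP.
apply: (@le_trans _ _ (\int[leb]_(x in oball a r) ((h_ n x)%:E + `|h_ m x - h_ n x|%:E))%E).
  apply: ge0_le_integral => //.
  - by move=> x _; rewrite lee_fin.
  - exact: measurable_funTS.
  - by apply: measurable_funTS; apply: emeasurable_funD.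
  - by move=> x _; rewrite -EFinD lee_fin -lerBlDl ler_norm.
rewrite ge0_integralD //; last 3 first.
- by move=> x _; rewrite lee_fin.
- exact: measurable_funTS.
- exact: measurable_funTS.
apply: leeD => //; by apply: ge0_subset_integral => //; exact: measurable_funTS.
Qed.

Hypothesis hcauchy : forall rho e, 0 < rho -> 0 < e -> exists N, forall m n,
  (N <= m)%N -> (N <= n)%N ->
  (\int[leb]_(x in inner rho) `|h_ m x - h_ n x|%:E <= e%:E)%E.

(** The value [p x] is nearly reached by some [h_ m y] with [m] large and [y] near [x]. A slightly
    smaller ball around [y] lies in the ball around [x], so the ball mean inequality bounds
    [h_ m y]; the Cauchy property then trades [h_ m] for [h_ n], with [N] independent of [x]. *)
Lemma jlimsup_ball_mean r e : 0 < r -> 0 < e -> exists N, forall n, (N <= n)%N ->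
  forall x, inner (r *+ 2) x ->
  ((r ^+ d * bvol leb * p x)%:E <= \int[leb]_(y in oball x r) (h_ n y)%:E + e%:E)%E.
Proof.
move=> r0 e0; have [N hN] := hcauchy r0 e0.
have b0 := bvol_gt0 hleb; have r20 : 0 < r *+ 2 by rewrite mulrn_wgt0.
have mI := measurable_inner Y r0.
exists N => n Nn x hx; have Yx := inner_sub r20 hx.
have xin : oball x r `<=` inner r.
  move=> y /(oballE _ _ r0) xy.
  have := @inner_half _ _ Y _ _ y r20 hx.
  by rewrite -[r *+ 2]mulr_natr mulfK //; apply; exact: ltW.
rewrite -(fineK (ball_integral_fin n x r0)) -EFinD lee_fin.
set I := fine _.
have I0 : 0 <= I by apply: fine_ge0; apply: integral_ge0 => y _; rewrite lee_fin.
(* Of the [d.+1] factors [s], [d] shrink the volume of the ball to radius [s * r] and one lowers the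
   value to [s * p x]. *)
apply: (@le_of_expr_le _ _ _ d.+1).
  by rewrite !mulr_ge0 ?exprn_ge0 ?jlimsup_ge0 // ltW.
move=> s /andP[s0 s1].
have [p0|] := eqVneq (p x) 0; first by rewrite p0 !mulr0 addr_ge0 // ltW.
move=> p0; have {}p0 : 0 < p x by rewrite lt_def p0 jlimsup_ge0.
have sp : s * p x < p x by rewrite gtr_pMl.
have sr : s * r < r by rewrite gtr_pMl.
have sr0 : 0 < s * r by rewrite mulr_gt0.
have rsr : 0 < r - s * r by rewrite subr_gt0.
have [N1 hN1] := natSinv_lt rsr.
have [m [y [Nm Yy xy hm]]] := jlimsup_gt Yx sp (maxn N N1).
have {}xy : eudist x y < r - s * r.
  by apply: lt_trans xy (hN1 _ _); rewrite leq_maxr.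
have sub : oball y (s * r) `<=` oball x r.
  move=> z /(oballE _ _ sr0) yz; apply/(oballE _ _ r0).
  by apply: le_lt_trans (eudist_triangle x y z) _; lra.
have yY : cball y (s * r) `<=` Y.
  apply: (cball_inner (ltW sr0) sr); apply: xin; apply/oballE => //.
  by apply: lt_trans xy _; rewrite gtrBl.
rewrite (_ : s ^+ d.+1 * _ = (s * r) ^+ d * bvol leb * (s * p x)); last first.
  by rewrite exprS exprMn; ring.
apply: (@le_trans _ _ ((s * r) ^+ d * bvol leb * h_ m y)).
  by rewrite ler_wpM2l ?(ltW hm) // mulr_ge0 ?exprn_ge0 // ltW.
rewrite -lee_fin; apply: le_trans (adm_ball_mean hd hleb hYo (ah m) sr0 yY) _.
apply: (@le_trans _ _ (\int[leb]_(z in oball x r) (h_ m z)%:E)%E).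
  apply: ge0_subset_integral => //; [exact: measurable_oball|exact: measurable_oball| |].
    by apply/measurable_EFinP; exact: measurable_funTS.
  by move=> z _; rewrite lee_fin.
apply: le_trans (ball_integral_le m n mI xin) _.
rewrite EFinD /I fineK ?ball_integral_fin //; apply: leeD => //.
by apply: hN => //; apply: leq_trans Nm; rewrite leq_maxl.
Qed.

(** By contradiction along translations tending to 0: [h_ n] is bounded and continuous at every
    point of [Y], so bounded convergence applies, although [h_ n] need not be uniformly
    continuous. *)
Lemma translation_continuous n rho e : 0 < rho -> 0 < e -> exists2 r, 0 < r & forall w,
  enorm w < r ->
  (\int[leb]_(x in inner rho) `|h_ n (vaff w 1 x) - h_ n x|%:E < e%:E)%E.
Proof.
move=> r0 e0; apply: contrapT => /forall2NP nh.
have hx (j : nat) : exists w, enorm w < j.+1%:R^-1 /\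
    ~ (\int[leb]_(x in inner rho) `|h_ n (vaff w 1 x) - h_ n x|%:E < e%:E)%E.
  have [|/existsNP[w /not_implyP h]] := nh j.+1%:R^-1; first by rewrite invr_gt0.
  by exists w.
have {hx} [u hu] := choice hx.
have [M M0 hM] := adm_bounded (ah n).
have mI := measurable_inner Y r0.
have mf j : measurable_fun (inner rho) (fun x => (`|h_ n (vaff (u j) 1 x) - h_ n x|)%:E).
  apply/measurable_EFinP; apply: measurable_funTS; apply: measurableT_comp => //.
  apply: measurable_funB => //; apply: measurableT_comp => //; exact: measurable_vaff.
have := @bounded_convergence _ _ _ leb _ mI (leb_inner_fin hleb hYb r0) _ (cst 0%E) M mf.
rewrite integral0 => h.
have cv : (fun j => \int[leb]_(x in inner rho)
    `|h_ n (vaff (u j) 1 x) - h_ n x|%:E)%E @ \oo --> 0%E.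
  apply: h.
    move=> j x _; rewrite !lee_fin normr_ge0 /=.
    have /andP[? ?] := hM x; have /andP[? ?] := hM (vaff (u j) 1 x).
    by rewrite ler_norml; apply/andP; split; lra.
  move=> x hx; apply: cvg_EFin; first exact: nearW.
  apply/cvgrPdist_lt => d1 d10; have Yx := inner_sub r0 hx.
  have [del del0 hdel] := adm_continuous hYo (ah n) Yx d10.
  have [N hN] := natSinv_lt del0.
  exists N => // j /= Nj; rewrite sub0r normrN normr_id distrC; apply: hdel.
  rewrite (_ : vaff (u j) 1 x = vaff x 1 (u j)); last first.
    by apply: eq_from_tnth => i; rewrite !tnth_vaff; ring.
  rewrite eudist_vaffl normr1 mul1r; apply: lt_trans (hu j).1 _; exact: hN.
have /fine_cvgP[_ /cvgrPdist_lt /(_ e e0) [N _ /(_ N (leqnn _))]] /= := cv.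
rewrite sub0r normrN => hlt; apply: (hu N).2.
have fi : (\int[leb]_(x in inner rho) `|h_ n (vaff (u N) 1 x) - h_ n x|%:E)%E \is a fin_num.
  apply: integrable_fin_num => //.
  apply: (@integrable_bounded _ _ _ _ _ mI (leb_inner_fin hleb hYb r0) _ M) => //.
  move=> x _; rewrite !lee_fin normr_ge0 /=.
  have /andP[? ?] := hM x; have /andP[? ?] := hM (vaff (u N) 1 x).
  by rewrite ler_norml; apply/andP; split; lra.
by rewrite -(fineK fi) lte_fin; apply: le_lt_trans hlt; rewrite ler_norm.
Qed.

(* Uniformity in [n] comes from the Cauchy property, by comparison with one fixed [h_ N]. *)
Lemma translation_equicontinuous rho e : 0 < rho -> 0 < e -> exists2 r, 0 < r &
  exists N, forall n, (N <= n)%N -> forall w, enorm w < r ->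
  (\int[leb]_(x in inner rho) `|h_ n (vaff w 1 x) - h_ n x|%:E <= e%:E)%E.
Proof.
move=> r0 e0; have e3 : 0 < e / 3 by rewrite divr_gt0.
have r2 : 0 < rho / 2 by rewrite divr_gt0.
have [N hN] := hcauchy r2 e3.
have [r rp hr] := translation_continuous N r0 e3.
exists (Num.min r (rho / 2)); first by rewrite lt_min rp.
exists N => n Nn w; rewrite lt_min => /andP[wr wr2].
have mI := measurable_inner Y r0; have mI2 := measurable_inner Y r2.
have mv : measurable_fun setT (vaff w 1) by exact: measurable_vaff.
pose g x := (`|h_ n x - h_ N x|)%:E.
have mg : measurable_fun setT g by apply/measurable_EFinP; exact: measurable_dist.
have mgv : measurable_fun setT (fun x => g (vaff w 1 x)) by exact: measurableT_comp.
have mt : measurable_fun setT (fun x => (`|h_ N (vaff w 1 x) - h_ N x|)%:E).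
  apply/measurable_EFinP; apply: measurableT_comp => //.
  by apply: measurable_funB => //; exact: measurableT_comp.
have mt' : measurable_fun setT (fun x => (`|h_ n (vaff w 1 x) - h_ n x|)%:E).
  apply/measurable_EFinP; apply: measurableT_comp => //.
  by apply: measurable_funB => //; exact: measurableT_comp.
have g0 x : (0 <= g x)%E by rewrite /g lee_fin.
have sub12 : inner rho `<=` inner (rho / 2).
  by apply: inner_mono => //; rewrite ler_pdivrMr // ler_peMr ?ler1n // ltW.
have subv : inner rho `<=` vaff w 1 @^-1` inner (rho / 2).
  move=> x hx; apply: (inner_half r0 hx).
  rewrite (_ : vaff w 1 x = vaff x 1 w); last first.
    by apply: eq_from_tnth => i; rewrite !tnth_vaff; ring.
  by rewrite eudist_vaffl normr1 mul1r ltW.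
apply: (@le_trans _ _ (\int[leb]_(x in inner rho)
   (g (vaff w 1 x) + (`|h_ N (vaff w 1 x) - h_ N x|%:E + g x)))%E).
  apply: ge0_le_integral => //.
  - exact: measurable_funTS.
  - apply: measurable_funTS; apply: emeasurable_funD => //; exact: emeasurable_funD.
  - move=> x _; rewrite /g -!EFinD lee_fin.
    rewrite (_ : h_ n (vaff w 1 x) - h_ n x = (h_ n (vaff w 1 x) - h_ N (vaff w 1 x)) +
      ((h_ N (vaff w 1 x) - h_ N x) + (h_ N x - h_ n x))); last by ring.
    by rewrite (distrC (h_ n x)) (le_trans (ler_normD _ _)) // lerD2l ler_normD.
rewrite ge0_integralD //; last 3 first.
- exact: measurable_funTS.
- by move=> x _; rewrite adde_ge0 // lee_fin.
- by apply: measurable_funTS; exact: emeasurable_funD.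
rewrite ge0_integralD //; [|exact: measurable_funTS|exact: measurable_funTS].
rewrite (_ : e%:E = (e / 3)%:E + ((e / 3)%:E + (e / 3)%:E))%E; last first.
  by rewrite -!EFinD; congr EFin; field.
apply: leeD; last apply: leeD.
(* Translation by [w], of norm below [rho / 2], carries [inner rho] into [inner (rho / 2)], where
   the Cauchy estimate was taken. *)
- apply: (@le_trans _ _ (\int[leb]_(x in vaff w 1 @^-1` inner (rho / 2)) g (vaff w 1 x))%E).
    apply: ge0_subset_integral => //; last exact: measurable_funTS.
    by rewrite -[X in measurable X]setTI; exact: mv.
  rewrite (integral_vaff hleb) //; last exact: measurable_funTS.
  by rewrite invr1 expr1n mul1e; exact: hN.
- exact/ltW/hr.
- apply: (@le_trans _ _ (\int[leb]_(x in inner (rho / 2)) g x)%E); last exact: hN.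
  by apply: ge0_subset_integral => //; exact: measurable_funTS.
Qed.

(* The restriction to [E], on which nu is dominated by a multiple of leb, allows passing from the
   L^1(leb) control of translations to integrals against nu. *)
Lemma jlimsup_integral_le (E : set V) rho k e : 0 < rho -> measurable E -> E `<=` inner rho ->
  0 <= k -> (forall A, measurable A -> A `<=` E -> (nu A <= k%:E * leb A)%E) -> 0 < e ->
  exists N, forall n, (N <= n)%N ->
  (\int[nu]_(x in E) (p x)%:E <= \int[nu]_(x in Y) (h_ n x)%:E + e%:E)%E.
Proof.
move=> r0 mE Ein k0 hk e0.
(* The factor [k + 1] absorbs the comparison constant [k] and is never zero. *)
pose e1 := e / 2 / (k + 1).
have k10 : 0 < k + 1 by rewrite ltr_wpDl.
have e10 : 0 < e1 by rewrite !divr_gt0.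
have [r' r'0 [N1 hN1]] := translation_equicontinuous r0 e10.
pose r := Num.min r' (rho / 2).
have rp : 0 < r by rewrite lt_min r'0 divr_gt0.
have r2rho : r *+ 2 <= rho.
  by rewrite -[r *+ 2]mulr_natr -ler_pdivlMr // ge_min lexx orbT.
have b0 := bvol_gt0 hleb.
pose v := r ^+ d * bvol leb.
have v0 : 0 < v by rewrite mulr_gt0 // exprn_gt0.
have ve0 : 0 < v * (e / 2) by rewrite mulr_gt0 // divr_gt0.
have [N2 hN2] := jlimsup_ball_mean rp ve0.
exists (maxn N1 N2) => n; rewrite geq_max => /andP[Nn1 Nn2].
have mB := measurable_oball (origin R d) r.
have mI := measurable_inner Y r0.
pose F (u : V * V) : \bar R := `|h_ n (vaff u.2 1 u.1) - h_ n u.1|%:E.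
have mF : measurable_fun setT F.
  apply/measurable_EFinP; apply: measurableT_comp => //; apply: measurable_funB.
    by apply: measurableT_comp => //; exact: measurable_vaff.
  by apply: measurableT_comp => //.
have F0 u : (0 <= F u)%E by rewrite /F lee_fin.
pose G x : \bar R := (\int[leb]_(z in oball (origin R d) r) F (x, z))%E.
have G0 x : (0 <= G x)%E by apply: integral_ge0.
have mG : measurable_fun setT G by exact: (measurable_leb_integral hleb).
(* The integral of [h_ n] over the ball around [x], recentred at the origin, is compared with the
   constant [h_ n x]; the displacement error is [G x]. *)
have pleG x : E x -> ((v * p x)%:E <= (v * h_ n x)%:E + (G x + (v * (e / 2))%:E))%E.
  move=> Ex; have xin : inner (r *+ 2) x.
    by apply: inner_mono (Ein _ Ex) => //; rewrite mulrn_wgt0.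
  apply: le_trans (hN2 n Nn2 x xin) _; rewrite addeA; apply: leeD => //.
  have := integral_vaff hleb x (ltr01 : 0 < 1 :> R) (measurable_oball x r)
    (measurable_funTS ((measurable_EFinP _ _).2 (mh n))) (fun y _ => h0 n y).
  rewrite invr1 expr1n mul1e => <-.
  have := oball_vaff x (ltr01 : 0 < 1 :> R) rp; rewrite mul1r => ->.
  have -> : ((v * h_ n x)%:E = \int[leb]_(z in oball (origin R d) r) (h_ n x)%:E)%E.
    by rewrite integral_cst // leb_oballE // -EFinM mulrC.
  have mFx : measurable_fun setT (fun z => F (x, z)) by exact: measurableT_comp.
  rewrite -ge0_integralD //; last 2 first.
  - by move=> z _; rewrite lee_fin.
  - exact: measurable_funTS.
  apply: ge0_le_integral => //.
  - by move=> z _; rewrite lee_fin.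
  - apply: measurable_funTS; apply/measurable_EFinP; apply: measurableT_comp => //.
    exact: measurable_vaff.
  - by apply: measurable_funTS; exact: emeasurable_funD.
  - by move=> z _; rewrite /F -EFinD lee_fin -lerBlDl vaff1C ler_norm.
have mp : measurable_fun setT (fun x => (p x)%:E).
  by apply/measurable_EFinP; exact: measurable_jlimsup.
have mhE : measurable_fun setT (fun x => (h_ n x)%:E) by apply/measurable_EFinP.
have EY : E `<=` Y by apply: subset_trans Ein _; exact: inner_sub.
have GE : (\int[nu]_(x in E) G x <= (v * (e / 2))%:E)%E.
  apply: (@le_trans _ _ (k%:E * \int[leb]_(x in E) G x)%E).
    rewrite -(ge0_integral_mscale leb mE (NngNum k0)) //; last exact: measurable_funTS.
    by apply: measure_le_integral => //.
  apply: (@le_trans _ _ (k%:E * (e1 * v)%:E)%E); last first.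
    have -> : (k%:E * (e1 * v)%:E = (v * (e / 2) * (k / (k + 1)))%:E)%E.
      by rewrite -EFinM /e1; congr EFin; field; rewrite gt_eqF.
    rewrite lee_fin.
    by rewrite ler_piMr ?(ltW ve0) // ler_pdivrMr // mul1r lerDl.
  apply: lee_wpmul2l => //.
  apply: (@le_trans _ _ (\int[leb]_(x in inner rho) G x)%E).
    by apply: ge0_subset_integral => //; exact: measurable_funTS.
  (* After the exchange, each inner integral is the L^1 displacement of [h_ n] under the translation
     by [z], hence at most [e1]. *)
  rewrite /G (leb_tonelli hleb) //.
  apply: (@le_trans _ _ (\int[leb]_(z in oball (origin R d) r) e1%:E)%E).
    apply: ge0_le_integral => //.
    - by move=> z _; exact: integral_ge0.
    - have mFs : measurable_fun setT (F \o (fun u => (u.2, u.1))).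
        by apply: measurableT_comp => //; exact: measurable_fun_pair.
      exact: (measurable_leb_integral hleb mB mI mFs (fun u => F0 (u.2, u.1))).
    - move=> z /(oballE _ _ rp); rewrite eudistC -enormE => zr.
      by apply: hN1 => //; apply: lt_le_trans zr _; rewrite ge_min lexx.
  by rewrite integral_cst // leb_oballE // -EFinM.
rewrite -(@lee_pmul2l _ v%:E) // ?lte_fin // -ge0_integralZl_EFin ?(ltW v0) //; last 2 first.
- by move=> x _; rewrite lee_fin; exact: jlimsup_ge0.
- exact: measurable_funTS.
apply: (@le_trans _ _ (\int[nu]_(x in E) ((v * h_ n x)%:E + (G x + (v * (e / 2))%:E)))%E).
  apply: ge0_le_integral => //.
  - by move=> x _; rewrite -EFinM lee_fin mulr_ge0 ?(ltW v0) // jlimsup_ge0.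
  - apply: measurable_funTS; under eq_fun do rewrite -EFinM.
    apply/measurable_EFinP; apply: measurable_funM => //; exact: measurable_jlimsup.
  - apply: measurable_funTS; apply: emeasurable_funD; last exact: emeasurable_funD.
    by apply/measurable_EFinP; exact: measurable_funM.
rewrite ge0_integralD //; last 4 first.
- by move=> x _; rewrite lee_fin mulr_ge0 // ltW.
- by apply/measurable_EFinP; apply: measurable_funTS; exact: measurable_funM.
- by move=> x _; rewrite adde_ge0 // lee_fin ltW.
- by apply: measurable_funTS; exact: emeasurable_funD.
rewrite ge0_integralD //; last 2 first.
- exact: measurable_funTS.
- by move=> x _; rewrite lee_fin ltW.
rewrite muleDr ?fin_num_adde_defl //.
apply: leeD.
  under eq_integral do rewrite EFinM.
  rewrite ge0_integralZl_EFin ?(ltW v0) //; last 2 first.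
  - by move=> x _; rewrite lee_fin.
  - exact: measurable_funTS.
  apply: lee_wpmul2l; first by rewrite lee_fin ltW.
  apply: ge0_subset_integral => //.
  - exact: eopen_measurable.
  - exact: measurable_funTS.
  - by move=> x _; rewrite lee_fin.
rewrite (_ : v%:E * e%:E = (v * (e / 2))%:E + (v * (e / 2))%:E)%E; last first.
  by rewrite -EFinM -EFinD; congr EFin; field.
apply: leeD => //; rewrite integral_cst //.
rewrite -[leRHS]mule1; apply: lee_wpmul2l; first by rewrite lee_fin ltW.
exact: probability_le1.
Qed.

(** Choose indices tending to infinity and centres tending to [x0] along which [h_] nearly reaches
    [p x0], and write the spherical inequality there. The spheres move with their centres, and
    because the upper limit is joint, the integrands still have upper limit at most [p] on the
    sphere around [x0]; reverse Fatou concludes. *)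
Lemma jlimsup_subharmonic : subharmonic leb Y (EFin \o p).
Proof.
split=> [//|//|x0 r r0 xY]; first exact: jlimsup_usc.
have b0 := bvol_gt0 hleb.
apply: (proj2 (sub_mean_ge hleb p x0 r)).
have [e e0 he] := cball_margin hYo xY (ltW r0).
have e2 : 0 < e / 2 by rewrite divr_gt0.
have hmarg := he.
have {}he z : inner e (sph_point x0 r z).
  by apply: hmarg; apply/cballE; [exact: ltW|apply: eudist_sph_point; exact: ltW].
have Yx0 : Y x0 by apply: xY; apply/cballE; rewrite ?eudistxx ltW.
apply/lee_addgt0Pr => eps eps0.
have eb0 : 0 < eps / bvol leb by rewrite divr_gt0.
rewrite -leeBlDr // -EFinB.
have -> : bvol leb * p x0 - eps = bvol leb * (p x0 - eps / bvol leb).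
  by rewrite mulrBr mulrCA divff ?gt_eqF // mulr1.
have pt : p x0 - eps / bvol leb < p x0 by rewrite gtrBl.
have [N0 hN0] := natSinv_lt e2.
have hk k : exists my : nat * V, [/\ (k <= my.1)%N,
    eudist x0 my.2 < k.+1%:R^-1, eudist x0 my.2 <= e / 2, Y my.2 &
    p x0 - eps / bvol leb < h_ my.1 my.2].
  have [m [y [km Yy xy hm]]] := jlimsup_gt Yx0 pt (maxn k N0).
  exists (m, y); split => //=.
  - by apply: leq_trans km; rewrite leq_maxl.
  - apply: (lt_le_trans xy); rewrite lef_pV2 ?posrE // ler_nat ltnS leq_maxl //.
  - by apply/ltW/(lt_trans xy)/hN0; rewrite leq_maxr.
have {hk} [my hmy] := choice hk.
have mS a : measurable_fun setT (sph_point a r) by exact: measurable_sph_point.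
apply: (@reverse_fatou _ _ _ leb _ (measurable_oball _ 1) (leb_oball_fin hleb _ ltr01)
  (fun k z => (h_ (my k).1 (sph_point (my k).2 r z))%:E) _ (K (e / 2))).
- move=> k; apply: measurable_funTS; apply/measurable_EFinP.
  by apply: measurableT_comp.
- apply: measurable_funTS; apply/measurable_EFinP.
  by apply: measurableT_comp => //; exact: measurable_jlimsup.
- move=> k z _; rewrite !lee_fin h0 /=.
  apply: (adm_local_bound hd hleb hYo c0 hc (ah _) (hC _) e2).
  by apply: (inner_half e0 (he z)); rewrite eudist_sph_center; have [] := hmy k.
- move=> z _ t; rewrite lte_fin => pzt.
  have [N hN] := jlimsup_lt (inner_sub e0 (he z)) pzt.
  exists N => k Nk; rewrite lee_fin; apply: ltW; have [km ky ky2 Yy _] := hmy k.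
  apply: hN; first exact: leq_trans Nk km.
    apply: (inner_sub e2); apply: (inner_half e0 (he z)).
    by rewrite eudist_sph_center.
  rewrite eudist_sph_center; apply: (lt_le_trans ky).
  by rewrite lef_pV2 ?posrE // ler_nat ltnS.
- move=> k; have [km ky ky2 Yy hlt] := hmy k.
  apply: (@le_trans _ _ (bvol leb * h_ (my k).1 (my k).2)%:E).
    by rewrite lee_fin ler_pM2l // ltW.
  apply: (proj1 (sub_mean_ge hleb _ _ _)).
  have [[_ [_ _ H]] _ _] := ah (my k).1; apply: H => // w /(cballE _ _ (ltW r0)) yw.
  (* [w'] is [w] translated by the difference of the centres: it lies in the closed ball around
     [x0], as close to [w] as the centres are to each other, so the margin [e] puts [w] in [Y]. *)
  pose w' := vaff (vaff x0 1 w) (-1) (my k).2.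
  have ww' : eudist w' w = eudist x0 (my k).2.
    by congr Num.sqrt; apply: eq_bigr => i _; rewrite !tnth_vaff; ring.
  have xw' : eudist x0 w' = eudist (my k).2 w.
    by congr Num.sqrt; apply: eq_bigr => i _; rewrite !tnth_vaff; ring.
  have : oball w' e `<=` Y by apply: hmarg; apply/cballE; rewrite ?xw' // ltW.
  apply; apply/oballE => //; rewrite ww'; apply: le_lt_trans ky2 _.
  by rewrite ltr_pdivrMr // ltr_pMr // ltr1n.
Qed.

End JointLimsup.

(** * Algebra of subharmonic functions and the transform Q2 *)

Section ShCb.
Variables (R : realType) (d : nat).
Local Notation V := (d.-tuple R).
Implicit Types (x y z a b w : V) (r s t e : R) (f g : V -> R).
Variable leb : {measure set V -> \bar R}.
Hypothesis hleb : is_lebesgue leb.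
Variable Y : set V.
Hypothesis hYo : eopen Y.

Local Notation B := (oball (origin R d) 1).

Lemma sph_point_in a r z : 0 < r -> cball a r `<=` Y -> Y (sph_point a r z).
Proof.
move=> r0; apply; apply/cballE; first exact: ltW.
by apply: eudist_sph_point; exact: ltW.
Qed.

Lemma measurable_fun_usc f : usc_on Y (EFin \o f) -> measurable_fun Y f.
Proof.
move=> uf; apply: (measurability _ (RGenInftyO.measurableE R)).
move=> _ [_ [t ->] <-]; apply: eopen_measurable => x [Yx /=].
rewrite in_itv /= => xt.
have [|r r0 hr] := uf x Yx t; first by rewrite lte_fin.
have [r' r'0 hr'] := hYo Yx.
exists (Num.min r r'); first by rewrite lt_min r0.
move=> y /oballE; rewrite !lt_min r0 r'0 => /(_ isT) /andP[h1 h2].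
have Uy : Y y by apply: hr'; apply/oballE.
split => //=; rewrite in_itv /=.
by have := hr y Uy; rewrite lte_fin; apply; apply/oballE.
Qed.

Lemma Cb_usc f : Cb Y f -> usc_on Y (EFin \o f).
Proof.
move=> [cf _] x Yx t; rewrite lte_fin -subr_gt0 => xt.
have [del d0 hd] := cf x Yx _ xt; exists del => // y Yy xy.
by rewrite lte_fin; have := hd y Yy xy; rewrite ltr_norml => /andP[h _]; lra.
Qed.

Lemma sh_CbP f : sh_Cb leb Y f <-> Cb Y f /\
  forall a r, 0 < r -> cball a r `<=` Y ->
    ((bvol leb * f a)%:E <= \int[leb]_(z in B) (f (sph_point a r z))%:E)%E.
Proof.
split=> [[cf [_ _ H]]|[cf H]]; split => //.
  by move=> a r r0 aY; apply/(sub_mean_ge hleb); exact: H.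
split=> //; first exact: Cb_usc.
by move=> a r r0 aY; apply/(sub_mean_ge hleb); exact: H.
Qed.

Lemma Cb_measurable f : Cb Y f -> measurable_fun Y f.
Proof. by move=> /Cb_usc; exact: measurable_fun_usc. Qed.

Lemma sph_integrable f a r : Cb Y f -> 0 < r -> cball a r `<=` Y ->
  leb.-integrable B (fun z => (f (sph_point a r z))%:E).
Proof.
move=> cf r0 aY; have [_ [M hM]] := cf.
apply: (@integrable_abs_bounded _ _ _ _ _ (measurable_oball _ 1)
  (leb_oball_fin hleb _ ltr01) _ M).
  apply/measurable_EFinP; apply: (@measurable_comp _ _ _ _ _ _ Y).
  - exact: eopen_measurable.
  - by move=> _ [z _ <-]; exact: sph_point_in.
  - exact: Cb_measurable.
  - by apply: measurable_funTS; exact: measurable_sph_point.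
by move=> z _; rewrite lee_fin; apply: hM; exact: sph_point_in.
Qed.

Lemma Cb_lin f g (u v k : R) : Cb Y f -> Cb Y g -> Cb Y (fun x => u * f x + v * g x + k).
Proof.
move=> [cf [Mf hf]] [cg [Mg hg]]; split.
  move=> x Yx e e0.
  have u1 : 0 < 2 * (`|u| + 1) by rewrite mulr_gt0 // ltr_wpDl.
  have v1 : 0 < 2 * (`|v| + 1) by rewrite mulr_gt0 // ltr_wpDl.
  have [df df0 hdf] := cf x Yx _ (divr_gt0 e0 u1).
  have [dg dg0 hdg] := cg x Yx _ (divr_gt0 e0 v1).
  exists (Num.min df dg); first by rewrite lt_min df0.
  move=> y Yy /oballE; rewrite !lt_min df0 dg0 => /(_ isT) /andP[h1 h2].
  have {}h1 := hdf y Yy (proj2 (oballE _ _ df0) h1).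
  have {}h2 := hdg y Yy (proj2 (oballE _ _ dg0) h2).
  rewrite (_ : _ - _ = u * (f x - f y) + v * (g x - g y)); last by ring.
  apply: le_lt_trans (ler_normD _ _) _; rewrite !normrM (splitr e).
  have K (w A : R) : A < e / (2 * (`|w| + 1)) -> 0 <= A -> `|w| * A < e / 2.
    move=> hA A0; apply: (@le_lt_trans _ _ ((`|w| + 1) * A)).
      by rewrite ler_wpM2r // lerDl.
    have w1 : 0 < `|w| + 1 by rewrite ltr_wpDl.
    have := hA; rewrite -(ltr_pM2l w1) => h; apply: lt_le_trans h _.
    rewrite le_eqVlt; apply/orP; left; apply/eqP; field.
    by rewrite gt_eqF.
  by rewrite ltrD // K.
exists (`|u| * Mf + `|v| * Mg + `|k|) => y Yy.
apply: le_trans (ler_normD _ _) _; rewrite lerD2r.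
apply: le_trans (ler_normD _ _) _; rewrite !normrM.
by rewrite lerD // ler_wpM2l // ?hf ?hg.
Qed.

(** A single closure property covers the subtraction of the infimum in [normalize] and the midpoints
    in [near_max_mid]. *)
Lemma sh_Cb_lin f g (u v k : R) : 0 <= u -> 0 <= v -> sh_Cb leb Y f -> sh_Cb leb Y g ->
  sh_Cb leb Y (fun x => u * f x + v * g x + k).
Proof.
move=> u0 v0 /sh_CbP[cf hf] /sh_CbP[cg hg]; apply/sh_CbP; split.
  exact: Cb_lin.
move=> a r r0 aY.
have mB := measurable_oball (origin R d) 1.
have intf := sph_integrable cf r0 aY; have intg := sph_integrable cg r0 aY.
rewrite (_ : (\int[leb]_(z in B) _ = \int[leb]_(z in B)
   (u%:E * (f (sph_point a r z))%:E + v%:E * (g (sph_point a r z))%:E + k%:E))%E); last first.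
  by apply: eq_integral => z _; rewrite !EFinD !EFinM.
have ik : leb.-integrable B (fun=> k%:E).
  by apply: (@integrable_abs_bounded _ _ _ _ _ mB (leb_oball_fin hleb _ ltr01) _ `|k|).
rewrite integralD //; last by apply: integrableD => //; exact: integrableZl.
rewrite integralD //; [|exact: integrableZl|exact: integrableZl].
rewrite !integralZl // integral_cst // bvolE //.
rewrite (_ : bvol leb * _ = u * (bvol leb * f a) + v * (bvol leb * g a) + k * bvol leb); last by ring.
rewrite !EFinD !(EFinM u) !(EFinM v) (EFinM k); apply: leeD => //; apply: leeD.
  by apply: lee_wpmul2l => //; exact: hf.
by apply: lee_wpmul2l => //; exact: hg.
Qed.

Lemma sh_Cb_cst k : sh_Cb leb Y (cst k).
Proof.
apply/sh_CbP; split.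
  split=> [x _ e e0|]; last by exists `|k|.
  by exists 1 => // y _ _; rewrite subrr normr0.
move=> a r r0 aY; rewrite /= integral_cst; last exact: measurable_oball.
by rewrite bvolE // -EFinM mulrC.
Qed.

Lemma sh_Cb_ext f g : (forall x, Y x -> f x = g x) -> sh_Cb leb Y f -> sh_Cb leb Y g.
Proof.
move=> fg /sh_CbP[[cf [M hM]] hf]; apply/sh_CbP; split.
  split; last by exists M => y Yy; rewrite -fg ?hM.
  move=> x Yx e e0; have [del d0 hdel] := cf x Yx e e0.
  by exists del => // y Yy xy; rewrite -!fg //; exact: hdel.
move=> a r r0 aY.
have Ya : Y a by apply: aY; apply/cballE; rewrite ?eudistxx ltW.
rewrite -fg // (le_trans (hf a r r0 aY)) // le_eqVlt; apply/orP; left; apply/eqP.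
by apply: eq_integral => z _; rewrite fg //; exact: sph_point_in.
Qed.

(** Intended for the limit function, which need not be in [Cb], so that [sh_Cb_lin] is out of reach.
    The case [t = 0] is separate because the threshold is divided by [t]. *)
Lemma subharmonic_scale f t : measurable_fun setT f -> (forall x, 0 <= f x) -> 0 <= t ->
  subharmonic leb Y (EFin \o f) -> subharmonic leb Y (fun x => (t * f x)%:E).
Proof.
move=> mf f0 t0 [_ uf hf]; split => //.
  move=> x Yx u; rewrite lte_fin => xu.
  move: t0; rewrite le_eqVlt => /predU1P[t0|t0].
    by exists 1 => // y _ _; move: xu; rewrite -t0 !mul0r lte_fin.
  have [|r r0 hr] := uf x Yx (u / t); first by rewrite lte_fin ltr_pdivlMr // mulrC.
  exists r => // y Yy xy; have := hr y Yy xy.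
  by rewrite !lte_fin ltr_pdivlMr // mulrC.
move=> a r r0 aY; apply/(sub_mean_ge hleb (fun x => t * f x)).
have /(sub_mean_ge hleb) h := hf a r r0 aY.
under eq_integral do rewrite EFinM.
rewrite ge0_integralZl_EFin //; last 3 first.
- exact: measurable_oball.
- by move=> z _; rewrite lee_fin.
- apply: measurable_funTS; apply/measurable_EFinP; apply: measurableT_comp => //.
  exact: measurable_sph_point.
by rewrite mulrCA EFinM; apply: lee_wpmul2l.
Qed.

End ShCb.

Section Q2Transform.
Variables (R : realType) (d : nat).
Local Notation V := (d.-tuple R).
Implicit Types (x y z : V) (r s t e : R) (f g : V -> R).
Variable Y : set V.

Local Notation Q f := (Q2 Y (EFin \o f)).

Lemma Q2_le f x y : Y y -> (Q f x <= (f y + sqdist x y)%:E)%E.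
Proof. by move=> Yy; apply: ereal_inf_lbound; exists y. Qed.

Lemma Q2_lt f x t : (Q f x < t%:E)%E -> exists2 y, Y y & f y + sqdist x y < t.
Proof.
by move=> /ereal_inf_lt[_ [y Yy <-]]; rewrite /= -EFinD lte_fin; exists y.
Qed.

Lemma Q2_ge f x (t : \bar R) : (forall y, Y y -> t <= (f y + sqdist x y)%:E)%E -> (t <= Q f x)%E.
Proof. by move=> h; apply: le_ereal_inf_tmp => _ [y Yy <-]; exact: h. Qed.

Lemma Q2_ge0 f x : (forall y, 0 <= f y) -> (0 <= Q f x)%E.
Proof. by move=> f0; apply: Q2_ge => y _; rewrite lee_fin addr_ge0 ?sqdist_ge0. Qed.

(** An infimum of functions continuous in [x] is upper semicontinuous, so strict sublevel sets are
    open for arbitrary [f]. *)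
Lemma measurable_Q2 f : measurable_fun setT (Q f).
Proof.
apply: measurable_fun_lt => t; apply: eopen_measurable => x /Q2_lt[y Yy xy].
have T0 : sqdist x y < t - f y by rewrite ltrBrDl.
have T1 : 0 <= t - f y by apply: le_trans (sqdist_ge0 x y) _; exact: ltW.
have E0 : eudist x y < Num.sqrt (t - f y).
  by rewrite /eudist ltr_sqrt // (le_lt_trans (sqdist_ge0 x y)).
exists (Num.sqrt (t - f y) - eudist x y); first by rewrite subr_gt0.
move=> z /oballE; rewrite subr_gt0 => /(_ E0) xz /=.
apply: le_lt_trans (Q2_le f z Yy) _; rewrite lte_fin -ltrBrDl.
rewrite -eudist_sqr -[ltRHS]sqr_sqrtr // ltr_pXn2r ?nnegrE ?eudist_ge0 ?sqrtr_ge0 //.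
apply: le_lt_trans (eudist_triangle z x y) _.
by rewrite eudistC -ltrBrDr.
Qed.

Lemma Q2_mid f g x : (forall y, 0 <= f y) -> (forall y, 0 <= g y) ->
  (2^-1%:E * (Q f x + Q g x) <= Q2 Y (fun y => (2^-1 * f y + 2^-1 * g y)%:E) x)%E.
Proof.
move=> f0 g0; apply: (@Q2_ge (fun y => 2^-1 * f y + 2^-1 * g y)) => y Yy.
apply: (@le_trans _ _ (2^-1%:E * ((f y + sqdist x y)%:E + (g y + sqdist x y)%:E))%E).
  by apply: lee_wpmul2l; [rewrite lee_fin invr_ge0|apply: leeD; exact: Q2_le].
by rewrite -EFinD -EFinM lee_fin le_eqVlt; apply/orP; left; apply/eqP; field.
Qed.

(** The cost is nonnegative and [s <= 1], so leaving it unscaled can only increase the infimum. *)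
Lemma Q2_scale f s x : 0 <= s <= 1 ->
  (s%:E * Q f x <= Q2 Y (fun y => (s * f y)%:E) x)%E.
Proof.
move=> /andP[s0 s1]; apply: (@Q2_ge (fun y => s * f y)) => y Yy.
apply: (@le_trans _ _ (s%:E * (f y + sqdist x y)%:E)%E).
  by apply: lee_wpmul2l => //; exact: Q2_le.
by rewrite -EFinM lee_fin mulrDr lerD2l ler_piMl // sqdist_ge0.
Qed.

(** A threshold above the infimum is beaten at one point [y], so pointwise control of the sequence
    at that [y] suffices. *)
Lemma Q2_limsup (f_ : nat -> V -> R) f x t :
  (forall y, Y y -> forall u, f y < u -> exists N, forall n, (N <= n)%N -> f_ n y < u) ->
  (Q f x < t%:E)%E -> exists N, forall n, (N <= n)%N -> (Q (f_ n) x <= t%:E)%E.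
Proof.
move=> hf /Q2_lt[y Yy]; rewrite -ltrBrDr => /(hf y Yy)[N hN]; exists N => n Nn.
by apply: le_trans (Q2_le _ x Yy) _; rewrite lee_fin -lerBrDr ltW // hN.
Qed.

End Q2Transform.

Lemma half_sum_le (R : realFieldType) (a b c : R) : a <= c -> b <= c ->
  2^-1 * a + 2^-1 * b <= c.
Proof. by move=> ? ?; lra. Qed.

Lemma half_diff_le (R : realFieldType) (a b c d e v : R) : 2^-1 * (a + b) <= c ->
  v <= a - d -> v <= b - e -> v <= c - (2^-1 * d + 2^-1 * e).
Proof. by move=> ? ? ?; lra. Qed.

Lemma abse_le (R : realDomainType) (x : \bar R) (C : R) :
  ((- C)%:E <= x -> x <= C%:E -> `|x| <= C%:E)%E.
Proof. by case: x => [r||] //; rewrite !lee_fin => h1 h2; rewrite ler_norml h1. Qed.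

(** Below the level [M] the map [a -> expR (- a / 2)] has slope at least [expR (- M / 2) / 2] in
    absolute value; this turns closeness of the exponentials back into closeness of the
    functions. *)
Lemma expR_half_dist (R : realType) (a b M : R) : a <= M -> b <= M ->
  `|a - b| <= 2 * expR (M / 2) * `|expR (- a / 2) - expR (- b / 2)|.
Proof.
wlog ab : a b / a <= b => [H|] aM bM.
  have [|/ltW] := leP a b; first by move=> ?; exact: H.
  by move=> ba; rewrite distrC [X in _ * X]distrC; exact: H.
rewrite distrC ger0_norm ?subr_ge0 // ger0_norm; last first.
  by rewrite subr_ge0 ler_expR ler_pM2r ?invr_gt0 // lerN2.
have -> : - a / 2 = - b / 2 + (b - a) / 2 by field.
rewrite expRD -{2}[expR (- b / 2)]mulr1 -mulrBr.
have h1 : (b - a) / 2 <= expR ((b - a) / 2) - 1.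
  by rewrite lerBrDl; exact: expR_ge1Dx.
have h2 : 1 <= expR (M / 2) * expR (- b / 2).
  rewrite -expRD -(@expR0 R) ler_expR -mulrDl divr_ge0 //.
  by rewrite subr_ge0.
have ba0 : 0 <= (b - a) / 2 by rewrite divr_ge0 ?subr_ge0.
rewrite -mulrA [X in _ * X]mulrA.
apply: (@le_trans _ _ (2 * (1 * ((b - a) / 2)))); first by rewrite mul1r mulrC divfK.
by rewrite ler_pM2l // ler_pM.
Qed.

(** With [u = expR (- a / 2)] and [v = expR (- b / 2)] this reads [(u - v)^2 + 2 u v = u^2 + v^2]:
    the midpoint convexity defect of the exponential is an exact square. *)
Lemma expR_half_sqr (R : realType) (a b : R) :
  (expR (- a / 2) - expR (- b / 2)) ^+ 2 + 2 * expR (- (2^-1 * a + 2^-1 * b)) =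
  expR (- a) + expR (- b).
Proof.
have -> : - (2^-1 * a + 2^-1 * b) = - a / 2 + - b / 2 by field.
have ea : expR (- a) = expR (- a / 2) ^+ 2.
  by rewrite -expRM_natl; congr expR; field.
have eb : expR (- b) = expR (- b / 2) ^+ 2.
  by rewrite -expRM_natl; congr expR; field.
by rewrite ea eb expRD; ring.
Qed.

(** * Maximizing sequences for the dual problem *)

Section MaximizingSequence.
Variables (R : realType) (d : nat).
Hypothesis hd : (0 < d)%N.
Local Notation V := (d.-tuple R).
Implicit Types (x y z a b w : V) (r s t e rho : R) (f g h psi : V -> R).
Variable leb : {measure set V -> \bar R}.
Hypothesis hleb : is_lebesgue leb.
Variables X Y : set V.
Hypotheses (hXo : eopen X) (hYo : eopen Y).
Variables mu nu : probability V R.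
Hypotheses (hmu : probs_on X mu) (hnu : probs_on Y nu).
Variable D : R.
Hypothesis D0 : 0 <= D.
Hypothesis hD : forall x y, X x -> Y y -> sqdist x y <= D.

Local Notation Q f := (Q2 Y (EFin \o f)).
Local Notation J f := (Jfun X Y mu nu (EFin \o f)).
Local Notation adm := (adm leb Y).

Let mX : measurable X. Proof. exact: eopen_measurable. Qed.
Let mY : measurable Y. Proof. exact: eopen_measurable. Qed.
Let muX : (mu X < +oo)%E. Proof. by rewrite hmu ltry. Qed.
Let nuY : (nu Y < +oo)%E. Proof. by rewrite hnu ltry. Qed.

Lemma int_cst_mu k : (\int[mu]_(x in X) k%:E = k%:E)%E.
Proof.
rewrite integral_cst //; transitivity (k%:E * 1)%E; last by rewrite mule1.
by congr (_ * _)%E; exact: hmu.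
Qed.

Lemma int_cst_nu k : (\int[nu]_(y in Y) k%:E = k%:E)%E.
Proof.
rewrite integral_cst //; transitivity (k%:E * 1)%E; last by rewrite mule1.
by congr (_ * _)%E; exact: hnu.
Qed.

Lemma Y_nonempty : exists y, Y y.
Proof.
apply: contrapT => /forallNP nY.
have : nu Y = 1%E by exact: hnu.
rewrite (_ : Y = set0) ?measure0; last by apply/seteqP; split => // y /nY.
by move=> /eqP; rewrite eqe eq_sym oner_eq0.
Qed.

Lemma Q2_bounded f k x y : (forall z, 0 <= f z) -> Y y -> f y <= k -> X x ->
  (0 <= Q f x <= (k + D)%:E)%E.
Proof.
move=> f0 Yy fk Xx; rewrite Q2_ge0 //=; apply: le_trans (Q2_le f x Yy) _.
by rewrite lee_fin lerD // hD.
Qed.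

Lemma Q2_int_fin f : (forall z, 0 <= f z) -> (\int[mu]_(x in X) Q f x)%E \is a fin_num.
Proof.
move=> f0; have [y Yy] := Y_nonempty.
apply: integrable_fin_num => //.
apply: (@integrable_bounded _ _ _ mu _ mX muX _ (f y + D)).
  by apply: measurable_funTS; exact: measurable_Q2.
by move=> x Xx; exact: (Q2_bounded f0 Yy).
Qed.

Lemma Cb_integrable f : Cb Y f -> nu.-integrable Y (EFin \o f).
Proof.
move=> cf; have [_ [M hM]] := cf.
apply: (@integrable_abs_bounded _ _ _ nu _ mY nuY _ M).
  by apply/measurable_EFinP; exact: Cb_measurable.
by move=> y Yy; rewrite lee_fin; exact: hM.
Qed.

Lemma adm_Cb h : adm h -> Cb Y h. Proof. by case=> -[]. Qed.

Lemma adm_int_fin h : adm h -> (\int[nu]_(y in Y) (h y)%:E)%E \is a fin_num.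
Proof. by move=> /adm_Cb/Cb_integrable; exact: integrable_fin_num. Qed.

(** Adding a constant shifts both integrals equally, as [mu] and [nu] have mass 1, so the infimum
    may be moved to 0. Points where [h] is nearly 0 then cost at most [D] from anywhere in [X]. *)
Lemma normalize psi : sh_Cb leb Y psi -> exists h,
  [/\ adm h, (J psi <= J h)%E & forall x, X x -> (Q h x <= D%:E)%E].
Proof.
move=> spsi; have [cpsi _] := spsi; have [_ [M hM]] := cpsi.
have [y0 Yy0] := Y_nonempty.
have hi : has_inf [set psi y | y in Y].
  split; first by exists (psi y0); exists y0.
  exists (- M) => _ [y Yy <-].
  by have := hM y Yy; rewrite ler_norml => /andP[].
pose i := inf [set psi y | y in Y].
have ile y : Y y -> i <= psi y by move=> Yy; apply: ge_inf; [case: hi|exists y].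
pose h y := if pselect (Y y) then psi y - i else 0.
have hin y : Y y -> h y = psi y - i by rewrite /h; case: pselect.
have h0 y : 0 <= h y by rewrite /h; case: pselect => // Yy; rewrite subr_ge0 ile.
have ah : adm h.
  split => //; last by move=> y; rewrite /h; case: pselect.
  have := sh_Cb_lin hleb hYo (- i) ler01 (lexx 0) spsi spsi.
  apply: sh_Cb_ext => // y Yy; rewrite hin //.
  by rewrite mul1r mul0r addr0.
have QD x : X x -> (Q h x <= D%:E)%E.
  move=> Xx; apply/lee_addgt0Pr => e e0.
  have [_ [y Yy <-] ye] := inf_adherent e0 hi.
  apply: le_trans (Q2_le h x Yy) _; rewrite -EFinD lee_fin addrC lerD ?hD //.
  by rewrite hin // lerBlDl ltW.
exists h; split => //.
have Qi x : X x -> (Q psi x <= Q h x + i%:E)%E.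
  move=> Xx; rewrite -leeBlDr //; apply: Q2_ge => y Yy; rewrite leeBlDr //.
  apply: le_trans (Q2_le psi x Yy) _; rewrite -EFinD lee_fin hin //.
  by rewrite le_eqVlt; apply/orP; left; apply/eqP; ring.
have Qlow x : X x -> (i%:E <= Q psi x)%E.
  move=> Xx; apply: Q2_ge => y Yy; rewrite lee_fin.
  by apply: le_trans (ile y Yy) _; rewrite lerDl sqdist_ge0.
have mQ f : measurable_fun X (Q f) by apply: measurable_funTS; exact: measurable_Q2.
have iQh : mu.-integrable X (Q h).
  apply: (@integrable_bounded _ _ _ mu _ mX muX _ D) => // x Xx.
  by rewrite QD // Q2_ge0.
have icst (m : probability V R) (A : set V) : measurable A -> (m A < +oo)%E ->
    m.-integrable A (fun=> i%:E).
  by move=> mA mfin; apply: (@integrable_abs_bounded _ _ _ m _ mA mfin _ `|i|).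
have iQi : mu.-integrable X (fun x => Q h x + i%:E)%E.
  by apply: integrableD => //; exact: icst.
have iQpsi : mu.-integrable X (Q psi).
  apply: (@integrable_abs_bounded _ _ _ mu _ mX muX _ (`|i| + D)) => // x Xx.
  apply: abse_le.
    apply: le_trans (Qlow x Xx); rewrite lee_fin opprD.
    by apply: (@le_trans _ _ (- `|i|)); [rewrite gerDl oppr_le0|by have := ler_norm (- i); rewrite normrN; lra].
  apply: le_trans (Qi x Xx) _; rewrite addeC EFinD.
  by apply: leeD; [rewrite lee_fin ler_norm|exact: QD].
have E1 : (\int[mu]_(x in X) Q psi x <= \int[mu]_(x in X) Q h x + i%:E)%E.
  apply: (@le_trans _ _ (\int[mu]_(x in X) (Q h x + i%:E))%E); first by apply: le_integral => // x; rewrite inE; exact: Qi.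
  rewrite integralD //; last exact: icst.
  by rewrite int_cst_mu.
have E2 : (\int[nu]_(y in Y) (psi y)%:E = \int[nu]_(y in Y) (h y)%:E + i%:E)%E.
  rewrite (_ : (\int[nu]_(y in Y) (psi y)%:E = \int[nu]_(y in Y) ((h y)%:E + i%:E))%E).
    rewrite integralD //; last 2 first.
    - by apply: Cb_integrable; exact: adm_Cb.
    - exact: icst.
    by rewrite int_cst_nu.
  by apply: eq_integral => y; rewrite inE => Yy; rewrite hin // -EFinD subrK.
rewrite /Jfun E2.
apply: (@le_trans _ _ (\int[mu]_(x in X) Q h x + i%:E - (\int[nu]_(y in Y) (h y)%:E + i%:E))%E).
  by apply: leeD.
rewrite -(fineK (Q2_int_fin h0)) -(fineK (adm_int_fin ah)) -!EFinD lee_fin.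
by rewrite le_eqVlt; apply/orP; left; apply/eqP; ring.
Qed.

Local Notation D2v := (D2 leb X Y mu nu).

Lemma J_le_D2 psi : sh_Cb leb Y psi -> (J psi <= D2v)%E.
Proof. by move=> spsi; apply: ereal_sup_ubound; exists psi. Qed.

Lemma JE h : adm h -> J h =
  (fine (\int[mu]_(x in X) Q h x) - fine (\int[nu]_(y in Y) (h y)%:E))%:E.
Proof.
move=> ah; have h0 : forall z, 0 <= h z by case: ah.
by rewrite EFinB (fineK (adm_int_fin ah)) (fineK (Q2_int_fin h0)).
Qed.

Lemma Q2_int_le_D h : (forall y, 0 <= h y) -> (forall x, X x -> (Q h x <= D%:E)%E) ->
  (\int[mu]_(x in X) Q h x <= D%:E)%E.
Proof.
move=> h0 QD; apply: (@le_trans _ _ (\int[mu]_(x in X) D%:E)%E).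
  apply: ge0_le_integral => //.
  - by move=> x _; exact: Q2_ge0.
  - by apply: measurable_funTS; exact: measurable_Q2.
by rewrite int_cst_mu.
Qed.

Lemma D2_le : (D2v <= D%:E)%E.
Proof.
apply: ge_ereal_sup => _ [psi spsi <-].
have [h [ah Jh QD]] := normalize spsi; apply: le_trans Jh _.
rewrite /Jfun leeBlDr ?adm_int_fin //; case: (ah) => _ h0 _.
apply: le_trans (Q2_int_le_D h0 QD) _; rewrite leeDl //.
by apply: integral_ge0 => y _; rewrite lee_fin.
Qed.

Lemma D2_ge0 : (0 <= D2v)%E.
Proof.
apply: (le_trans _ (J_le_D2 (sh_Cb_cst hleb Y 0))).
rewrite /Jfun /= integral0 sube0; apply: integral_ge0 => x _.
by apply: (@Q2_ge0 _ _ _ (cst 0)).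
Qed.

Lemma D2_fin : D2v \is a fin_num.
Proof. by rewrite ge0_fin_numE ?D2_ge0 // (le_lt_trans D2_le) ?ltry. Qed.

(* [D + 1] bounds the mass of a near-maximizer normalized to have infimum 0, since the integral of
   its transform is at most [D] and the value of the dual functional is at least [-1]; keeping it as
   a constraint makes the set convex. *)
Definition near_max (n : nat) : set (V -> R) := [set h | [/\ adm h,
  (\int[nu]_(y in Y) (h y)%:E <= (D + 1)%:E)%E & (D2v - (n.+1%:R^-1)%:E <= J h)%E]].

Lemma near_max_nonempty n : exists h, near_max n h.
Proof.
have n0 : 0 < n.+1%:R^-1 :> R by rewrite invr_gt0.
have [_ [psi spsi <-] hpsi] := ub_ereal_sup_adherent n0 D2_fin.
have [h [ah Jh QD]] := normalize spsi.
have JD : (D2v - (n.+1%:R^-1)%:E <= J h)%E by apply: le_trans Jh; exact: ltW.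
exists h; split => //; case: (ah) => _ h0 _.
have h1 : (- 1 <= J h)%E.
  apply: le_trans JD; rewrite -(fineK D2_fin) -EFinB lee_fin.
  rewrite lerBrDr; apply: (@le_trans _ _ 0); last by rewrite fine_ge0 // D2_ge0.
  by rewrite addrC subr_le0 invf_le1 // ler1n.
have := Q2_int_le_D h0 QD; move: h1; rewrite JE // -(fineK (Q2_int_fin h0)).
by rewrite -(fineK (adm_int_fin ah)) !lee_fin /=; lra.
Qed.

Lemma near_max_mono n m : (n <= m)%N -> near_max m `<=` near_max n.
Proof.
move=> nm h [ah hC hJ]; split => //; apply: le_trans hJ.
rewrite leeB // lee_fin lef_pV2 ?posrE // ler_nat ltnS //.
Qed.

Lemma near_max_mid n f g : near_max n f -> near_max n g ->
  near_max n (fun y => 2^-1 * f y + 2^-1 * g y).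
Proof.
move=> [af fC fJ] [ag gC gJ].
have i2 : 0 <= 2^-1 :> R by rewrite invr_ge0.
case: (af) => sf f0 fY; case: (ag) => sg g0 gY.
have am : adm (fun y => 2^-1 * f y + 2^-1 * g y).
  split => [|y|y nY].
  - apply: sh_Cb_ext (sh_Cb_lin hleb hYo 0 i2 i2 sf sg) => // y _.
    by rewrite addr0.
  - by rewrite addr_ge0 // mulr_ge0.
  - by rewrite fY // gY // !mulr0 addr0.
have mf k : adm k -> measurable_fun Y (EFin \o k) by move=> /(adm_measurableE hYo); exact.
have Im : (\int[nu]_(y in Y) (2^-1 * f y + 2^-1 * g y)%:E =
   2^-1%:E * \int[nu]_(y in Y) (f y)%:E + 2^-1%:E * \int[nu]_(y in Y) (g y)%:E)%E.
  under eq_integral do rewrite EFinD !EFinM.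
  rewrite integralD //; last 2 first.
  - by apply: integrableZl => //; apply: Cb_integrable; exact: adm_Cb.
  - by apply: integrableZl => //; apply: Cb_integrable; exact: adm_Cb.
  rewrite !integralZl //; by apply: Cb_integrable; exact: adm_Cb.
have iQ k : (forall y, 0 <= k y) -> mu.-integrable X (Q k).
  move=> k0; have [y Yy] := Y_nonempty.
  apply: (@integrable_bounded _ _ _ mu _ mX muX _ (k y + D)).
    by apply: measurable_funTS; exact: measurable_Q2.
  by move=> x Xx; exact: (Q2_bounded k0 Yy).
have m0 y : 0 <= 2^-1 * f y + 2^-1 * g y by rewrite addr_ge0 // mulr_ge0.
have QI : (2^-1%:E * (\int[mu]_(x in X) Q f x + \int[mu]_(x in X) Q g x) <=
    \int[mu]_(x in X) Q (fun y => (2^-1 * f y + 2^-1 * g y)%R) x)%E.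
  have iQf := iQ _ f0; have iQg := iQ _ g0.
  rewrite -integralD // -integralZl //; last exact: integrableD.
  apply: le_integral => //.
  - by apply: integrableZl => //; exact: integrableD.
  - exact: iQ.
  - by move=> x _; exact: Q2_mid.
split => //.
  rewrite Im; move: fC gC; rewrite -(fineK (adm_int_fin af)) -(fineK (adm_int_fin ag)).
  by rewrite -!EFinM -EFinD !lee_fin; exact: half_sum_le.
move: fJ gJ; rewrite !JE // -(fineK D2_fin) -EFinB !lee_fin /= Im.
rewrite -(fineK (adm_int_fin af)) -(fineK (adm_int_fin ag)) /=.
move: QI; rewrite -(fineK (Q2_int_fin f0)) -(fineK (Q2_int_fin g0)) -(fineK (Q2_int_fin m0)).
by rewrite -EFinD -EFinM lee_fin /=; exact: half_diff_le.
Qed.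

Definition expmass h : \bar R := (\int[nu]_(y in Y) (expR (- h y))%:E)%E.

Lemma measurable_expRN h s : measurable_fun setT h ->
  measurable_fun setT (fun y => (expR (- h y / s))%:E).
Proof.
move=> mh; apply/measurable_EFinP; apply: measurableT_comp => //.
by apply: measurable_funM => //; exact: measurable_funN.
Qed.

Lemma measurable_expRN1 h : measurable_fun setT h ->
  measurable_fun setT (fun y => (expR (- h y))%:E).
Proof.
by move=> mh; apply/measurable_EFinP; apply: measurableT_comp => //; exact: measurable_funN.
Qed.

Lemma expmass01 h : adm h -> (0 <= expmass h <= 1)%E.
Proof.
move=> ah; have mh := adm_measurable hYo ah; have h0 := adm_ge0 ah.
rewrite integral_ge0 /=; last by move=> y _; rewrite lee_fin expR_ge0.
apply: (@le_trans _ _ (\int[nu]_(y in Y) 1)%E); last by rewrite int_cst_nu.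
apply: ge0_le_integral => //.
- by apply: measurable_funTS; exact: measurable_expRN1.
- by move=> y _; rewrite lee_fin -(@expR0 R) ler_expR oppr_le0.
Qed.

Lemma expmass_fin h : adm h -> expmass h \is a fin_num.
Proof.
by move=> /expmass01 /andP[h0 h1]; rewrite ge0_fin_numE // (le_lt_trans h1) ?ltry.
Qed.

Lemma expmass_mid f g : adm f -> adm g -> adm (fun y => 2^-1 * f y + 2^-1 * g y) ->
  (\int[nu]_(y in Y) ((expR (- f y / 2) - expR (- g y / 2)) ^+ 2)%:E =
   (fine (expmass f) + fine (expmass g)
    - 2 * fine (expmass (fun y => 2^-1 * f y + 2^-1 * g y)))%:E)%E.
Proof.
move=> af ag am; have mf := adm_measurable hYo af; have mg := adm_measurable hYo ag.
have mm := adm_measurable hYo am.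
have mS : measurable_fun setT (fun y => ((expR (- f y / 2) - expR (- g y / 2)) ^+ 2)%:E).
  apply/measurable_EFinP; apply: measurable_funX; apply: measurable_funB;
  by apply/measurable_EFinP; exact: measurable_expRN.
set I := integral _ _ _.
pose F h y : \bar R := (expR (- h y))%:E.
have F0 h y : Y y -> (0 <= F h y)%E by move=> _; rewrite lee_fin expR_ge0.
have mF h : adm h -> measurable_fun Y (F h).
  by move=> ah; apply: measurable_funTS; apply: measurable_expRN1; exact: (adm_measurable hYo ah).
pose m y := 2^-1 * f y + 2^-1 * g y.
have mm' : measurable_fun Y (fun y => 2%:E * F m y)%E.
  by apply: emeasurable_funM => //; exact: mF.
have S0 y : Y y -> (0 <= ((expR (- f y / 2) - expR (- g y / 2)) ^+ 2)%:E)%E.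
  by move=> _; rewrite lee_fin sqr_ge0.
have m0 y : Y y -> (0 <= 2%:E * F m y)%E.
  by move=> Yy; rewrite mule_ge0 ?F0 // lee_fin.
have E1 := ge0_integralD nu mY S0 (measurable_funTS mS) m0 mm'.
have E2 := ge0_integralD nu mY (@F0 f) (mF _ af) (@F0 g) (mF _ ag).
have E3 := ge0_integralZl_EFin nu mY (@F0 m) (mF _ am) (ler0n R 2).
move: E1; rewrite E3 -[X in (_ + 2%:E * X)%E]/(expmass m) -/I.
rewrite (eq_integral (fun y => F f y + F g y)%E); last first.
  by move=> y _; rewrite /F /m -EFinM -!EFinD expR_half_sqr.
rewrite E2 -[integral _ _ (F f)]/(expmass f) -[integral _ _ (F g)]/(expmass g).
rewrite -(fineK (expmass_fin af)) -(fineK (expmass_fin ag)) -(fineK (expmass_fin am)).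
rewrite -EFinM -EFinD => E; rewrite EFinB.
transitivity (I + (2 * fine (expmass m))%:E - (2 * fine (expmass m))%:E)%E.
  by rewrite addeK.
by rewrite E.
Qed.

(* Minimizing the strictly convex functional [expmass] over the decreasing convex sets [near_max n]
   forces [expR (- h_ n / 2)] to be Cauchy in L^2(nu), by the midpoint identity [expmass_mid]. *)
Lemma maximizing_cauchy : exists h_ : nat -> V -> R, [/\ forall n, near_max n (h_ n) &
  forall e, 0 < e -> exists N, forall m n, (N <= m)%N -> (N <= n)%N ->
    (\int[nu]_(y in Y) ((expR (- h_ m y / 2) - expR (- h_ n y / 2)) ^+ 2)%:E <= e%:E)%E].
Proof.
pose P n := [set fine (expmass h) | h in near_max n].
have P0 n v : P n v -> 0 <= v <= 1.
  move=> [h [ah _ _] <-]; have /andP[h0 h1] := expmass01 ah.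
  by rewrite fine_ge0 //= -lee_fin fineK // expmass_fin.
have hP n : has_inf (P n).
  split; first by have [h hh] := near_max_nonempty n; exists (fine (expmass h)), h.
  by exists 0 => v /P0 /andP[].
pose s n := inf (P n).
have s_le n h : near_max n h -> s n <= fine (expmass h).
  by move=> hh; apply: ge_inf; [case: (hP n)|exists h].
have smono n m : (n <= m)%N -> s n <= s m.
  move=> nm; apply: lb_le_inf; first by case: (hP m).
  by move=> _ [h hh <-]; apply: s_le; exact: near_max_mono hh.
have s1 n : s n <= 1.
  have [h hh] := near_max_nonempty n; apply: le_trans (s_le n h hh) _.
  have ph : P n (fine (expmass h)) by exists h.
  by have /andP[] := P0 n _ ph.
have hx n : exists h, near_max n h /\ fine (expmass h) < s n + n.+1%:R^-1.
  have n0 : 0 < n.+1%:R^-1 :> R by rewrite invr_gt0.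
  by have [_ [h hh <-] hlt] := inf_adherent n0 (hP n); exists h.
have [h_ hh] := choice hx.
exists h_; split => [n|e e0]; first by case: (hh n).
have hs : has_sup [set s n | n in setT].
  by split; [exists (s 0%N), 0%N|exists 1 => _ [n _ <-]].
have e3 : 0 < e / 3 by rewrite divr_gt0.
have [_ [N1 _ <-] hN1] := sup_adherent e3 hs.
have [N2 hN2] := natSinv_lt e3.
(* For [m <= n] the midpoint lies in [near_max m], so its mass is at least [s m]; the defect is then
   at most [s n - s m + m.+1%:R^-1 + n.+1%:R^-1], and each of the three parts is below [e / 3]. *)
have key m n : (N1 <= m)%N -> (N2 <= m)%N -> (m <= n)%N ->
    (\int[nu]_(y in Y) ((expR (- h_ m y / 2) - expR (- h_ n y / 2)) ^+ 2)%:E <= e%:E)%E.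
  move=> N1m N2m mn; have [hm hm'] := hh m; have [hn hn'] := hh n.
  have hn2 := near_max_mono mn hn; have hmid := near_max_mid hm hn2.
  have smid := s_le _ _ hmid.
  case: hm hn2 hmid => am _ _ [an _ _] [ad _ _].
  rewrite expmass_mid // lee_fin.
  have sn : s n <= sup [set s n | n in setT].
    by apply: ub_le_sup; [case: hs|exists n].
  have sm := smono _ _ N1m.
  have := hN2 _ N2m; have := hN2 _ (leq_trans N2m mn).
  move: hm' hn' smid sn sm hN1.
  move: (fine _) (fine _) (fine _) (s n) (s m) (s N1) (sup _) (n.+1%:R^-1) (m.+1%:R^-1).
  move=> a1 a2 a3 a4 a5 a6 a7 a8 a9; move=> *.
  lra.
exists (maxn N1 N2) => m n; rewrite !geq_max => /andP[m1 m2] /andP[n1 n2].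
have [mn|/ltnW nm] := leqP m n; first exact: key.
rewrite (_ : (\int[nu]_(y in Y) _ = \int[nu]_(y in Y)
  ((expR (- h_ n y / 2) - expR (- h_ m y / 2)) ^+ 2)%:E)%E); first exact: key.
by apply: eq_integral => y _; congr EFin; rewrite -sqrrN opprB.
Qed.

Lemma D2vE : D2v = (fine D2v)%:E. Proof. by rewrite fineK // D2_fin. Qed.

(* On a segment [t -> J (t p)], upper semicontinuity and [Q (s p) >= s (Q p)] replace continuity:
   the least [t] with [D2 <= J (t p)] satisfies the equality. *)
Lemma D2_eq_J_scale (p : V -> R) : measurable_fun setT p -> (forall y, 0 <= p y) ->
  (\int[nu]_(y in Y) (p y)%:E)%E \is a fin_num -> (D2v <= J p)%E ->
  exists2 t, 0 <= t <= 1 & D2v = J (fun y => t * p y).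
Proof.
move=> mp p0 fp; pose b := fine (\int[nu]_(y in Y) (p y)%:E)%E.
pose F t := fine (\int[mu]_(x in X) Q (fun y => (t * p y)%R) x)%E.
have b0 : 0 <= b by apply: fine_ge0; apply: integral_ge0 => y _; rewrite lee_fin.
have tp0 t : 0 <= t -> forall y, 0 <= t * p y by move=> t0 y; exact: mulr_ge0.
have FE t : 0 <= t -> (\int[mu]_(x in X) Q (fun y => (t * p y)%R) x = (F t)%:E)%E.
  by move=> /tp0 h; rewrite /F fineK //; exact: Q2_int_fin.
have JtE t : 0 <= t -> J (fun y => t * p y) = (F t - t * b)%:E.
  move=> t0; rewrite /Jfun FE //; under eq_integral do rewrite /= EFinM.
  rewrite ge0_integralZl_EFin //; last 2 first.
  - by move=> y _; rewrite lee_fin.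
  - by apply/measurable_EFinP; exact: measurable_funTS.
  by rewrite -(fineK fp) -/b -EFinM EFinB.
move: (D2vE) D2_ge0; set v := fine D2v => vE; rewrite vE lee_fin => v0 vJ.
pose T := [set t | 0 <= t <= 1 /\ v <= F t - t * b].
have T1 : T 1.
  split; first by rewrite ler01 lexx.
  rewrite -lee_fin -JtE //; apply: (le_trans vJ); rewrite le_eqVlt; apply/orP; left.
  by apply/eqP; congr (Jfun X Y mu nu _); apply/funext => y /=; rewrite mul1r.
have hT : has_inf T by split; [exists 1|exists 0 => t [/andP[]]].
pose u := inf T.
have u0 : 0 <= u by apply: lb_le_inf; [case: hT|move=> t [/andP[]]].
have uT t : T t -> u <= t by move=> Tt; apply: ge_inf => //; case: hT.
have u1 : u <= 1 by exact: uT.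
have [y0 Yy0] := Y_nonempty.
have hx n : exists t, T t /\ t < u + n.+1%:R^-1.
  have n0 : 0 < n.+1%:R^-1 :> R by rewrite invr_gt0.
  by have [t Tt tl] := inf_adherent n0 hT; exists t.
have [t_ ht] := choice hx.
have t_0 n : 0 <= t_ n by have [[/andP[]]] := ht n.
(* Reverse Fatou along [t_ n], which tends to the infimum [u], shows that [u] itself belongs to
   [T]. *)
have vu : v <= F u - u * b.
  rewrite lerBrDr -lee_fin -FE //.
  apply: (@reverse_fatou _ _ _ mu _ mX muX (fun n => Q (fun y => t_ n * p y)) _ (p y0 + D)).
  - by move=> n; apply: measurable_funTS; exact: measurable_Q2.
  - by apply: measurable_funTS; exact: measurable_Q2.
  - move=> n x Xx; apply: (Q2_bounded _ Yy0) => //; first exact: tp0.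
    by rewrite ler_piMl //; have [[/andP[]]] := ht n.
  - move=> x Xx r; apply: Q2_limsup => y Yy w uw.
    (* The [+ 1] in the denominator covers [p y = 0]. *)
    have e0 : 0 < (w - u * p y) / (p y + 1).
      by rewrite divr_gt0 ?subr_gt0 // ltr_wpDl.
    have [N hN] := natSinv_lt e0; exists N => n Nn.
    have [_ tl] := ht n; have pn := hN n Nn.
    have : t_ n <= u + (w - u * p y) / (p y + 1).
      by apply: ltW; apply: (lt_trans tl); rewrite ltrD2l.
    move=> /(ler_wpM2r (p0 y)) h; apply: le_lt_trans h _.
    rewrite mulrDl -ltrBrDl mulrAC ltr_pdivrMr ?ltr_wpDl //.
    by rewrite ltr_pM2l ?subr_gt0 // ltrDl.
  - move=> n; rewrite FE // lee_fin.
    have [[_ h] _] := ht n; rewrite -lerBrDr (le_trans h) // lerB // ler_wpM2r //.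
    by apply: uT; case: (ht n).
have [ev|nev] := eqVneq v (F u - u * b).
  by exists u; rewrite ?u0 ?u1 // JtE // -ev.
have {nev} vlt : v < F u - u * b by rewrite lt_neqAle nev.
pose Dl := F u - u * b.
have Dl0 : 0 < Dl by apply: le_lt_trans vlt.
(* If the value [Dl] at [u] overshoots [v], then by [Q2_scale] the value at [s * u] with
   [s = v / Dl] is still at least [v]; minimality of [u] leaves only [u = 0]. *)
have [s [s0 s1 vs]] : exists s, [/\ 0 <= s, s < 1 & v = s * Dl].
  exists (v / Dl); split; first by rewrite divr_ge0 // ltW.
    by rewrite ltr_pdivrMr // mul1r.
  by rewrite divfK // gt_eqF.
have sF : s * F u <= F (s * u).
  rewrite -lee_fin EFinM -FE // -FE ?mulr_ge0 //.
  have y0u : 0 <= u * p y0 by exact: tp0.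
  have iQ : mu.-integrable X (Q (fun y => u * p y)).
    apply: (@integrable_bounded _ _ _ mu _ mX muX _ (u * p y0 + D)).
      by apply: measurable_funTS; exact: measurable_Q2.
    by move=> x Xx; apply: (Q2_bounded _ Yy0) => //; exact: tp0.
  rewrite -ge0_integralZl_EFin //; last 2 first.
  - by move=> x _; apply: Q2_ge0; exact: tp0.
  - by apply: measurable_funTS; exact: measurable_Q2.
  apply: ge0_le_integral => //.
  - by move=> x _; rewrite mule_ge0 // Q2_ge0 //; exact: tp0.
  - by apply: emeasurable_funM => //; apply: measurable_funTS; exact: measurable_Q2.
  - by apply: measurable_funTS; exact: measurable_Q2.
  - move=> x _; have s01 : 0 <= s <= 1 by rewrite s0 ltW.
    apply: le_trans (Q2_scale Y (fun y => u * p y) x s01) _.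
    rewrite le_eqVlt; apply/orP; left; apply/eqP; congr (Q2 Y _ x).
    by apply/funext => y /=; rewrite mulrA.
have Tsu : T (s * u).
  split; first by rewrite mulr_ge0 //= mulr_ile1 // ltW.
  rewrite lerBrDr; apply: le_trans sF.
  by rewrite vs /Dl -mulrA -mulrDr subrK.
have {}u00 : u = 0.
  have := uT _ Tsu; rewrite -subr_ge0 (_ : s * u - u = - ((1 - s) * u)); last by ring.
  rewrite oppr_ge0 pmulr_rle0 ?subr_gt0 // => h.
  by apply/eqP; rewrite eq_le h u0.
(* At [u = 0] an overshoot would contradict that the constant 0 competes in [D2]. *)
have := J_le_D2 (sh_Cb_cst hleb Y 0).
rewrite (_ : EFin \o cst 0 = EFin \o (fun y => 0 * p y)); last first.
  by apply/funext => y /=; rewrite mul0r.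
by rewrite JtE // vE lee_fin leNgt -u00 vlt.
Qed.

Variable c : R.
Hypothesis c0 : 0 < c.
Hypothesis hc : forall A, measurable A -> A `<=` Y -> (c%:E * leb A <= nu A)%E.

(** On [inner Y rho] all [h_ n] lie below one constant [M], where [expR_half_dist] inverts the
    exponential; the lower bound [c] on the density passes from nu to [leb]. *)
Lemma maximizing_cauchy_leb : exists h_ : nat -> V -> R, [/\ forall n, near_max n (h_ n) &
  forall rho e, 0 < rho -> 0 < e -> exists N, forall m n, (N <= m)%N -> (N <= n)%N ->
    (\int[leb]_(x in inner Y rho) `|h_ m x - h_ n x|%:E <= e%:E)%E].
Proof.
have [h_ [hm hcau]] := maximizing_cauchy.
exists h_; split => // rho e r0 e0.
have ah n : adm (h_ n) by case: (hm n).
have mh n : measurable_fun setT (h_ n) by exact: (adm_measurable hYo (ah n)).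
have hC n : (\int[nu]_(y in Y) (h_ n y)%:E <= (D + 1)%:E)%E by case: (hm n).
pose M := locbound leb c (D + 1) rho.
pose L := 2 * expR (M / 2).
have L0 : 0 < L by rewrite mulr_gt0 // expR_gt0.
(* Chosen so that the final bound [L * eta + (L / eta) * eta ^+ 2 = 2 * L * eta] equals [c * e]. *)
pose eta := c * e / (2 * L).
have eta0 : 0 < eta by rewrite divr_gt0 // mulr_gt0.
have [N hN] := hcau (eta ^+ 2) (exprn_gt0 2 eta0).
exists N => m n Nm Nn.
have mI := measurable_inner Y r0; have IY := inner_sub r0 : inner Y rho `<=` Y.
have md : measurable_fun setT (fun x => `|h_ m x - h_ n x|).
  by apply: measurableT_comp => //; exact: measurable_funB.
apply: (le_trans (leb_le_nu c0 hc mI IY md (fun x => normr_ge0 _))).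
rewrite lee_pdivrMl // -EFinM.
pose S y := (expR (- h_ m y / 2) - expR (- h_ n y / 2)) ^+ 2.
have mS : measurable_fun setT (fun y => (S y)%:E).
  apply/measurable_EFinP; apply: measurable_funX; apply: measurable_funB;
  by apply/measurable_EFinP; exact: measurable_expRN.
have S0 y : 0 <= S y by exact: sqr_ge0.
(* The pointwise bound of [|t|] by [eta + t^2 / eta] takes the place of the Cauchy-Schwarz
   inequality. *)
apply: (@le_trans _ _ (\int[nu]_(x in inner Y rho) ((L * eta)%:E + (L / eta)%:E * (S x)%:E))%E).
  apply: ge0_le_integral => //.
  - by apply: measurable_funTS; apply/measurable_EFinP.
  - apply: measurable_funTS; apply: emeasurable_funD => //.
    exact: emeasurable_funM.
  - move=> x hx; rewrite -EFinM -EFinD lee_fin.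
    have bm k := adm_local_bound hd hleb hYo c0 hc (ah k) (hC k) r0 hx.
    apply: le_trans (expR_half_dist (bm m) (bm n)) _.
    rewrite -/L /S; move: (_ - _) => t.
    rewrite (_ : _ + _ = L * (eta + eta^-1 * t ^+ 2)); last by ring.
    rewrite ler_pM2l // -real_normK ?num_real //.
    have t0 := normr_ge0 t; move: `|t| t0 => u u0.
    have [ue|/ltW ue] := leP u eta.
      by apply: le_trans ue _; rewrite lerDl mulr_ge0 ?sqr_ge0 // invr_ge0 ltW.
    apply: (@le_trans _ _ (eta^-1 * u ^+ 2)); last by rewrite lerDr ltW.
    by rewrite ler_pdivlMl // expr2 ler_wpM2r.
have mLS : measurable_fun setT (fun x => (L / eta)%:E * (S x)%:E)%E.
  exact: emeasurable_funM.
have LS0 x : (0 <= (L / eta)%:E * (S x)%:E)%E.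
  by rewrite mule_ge0 // lee_fin // divr_ge0 // ltW.
rewrite ge0_integralD //; last 2 first.
- by move=> x _; rewrite lee_fin mulr_ge0 // ltW.
- exact: measurable_funTS.
have Le0 : 0 <= L / eta by rewrite divr_ge0 // ltW.
rewrite ge0_integralZl_EFin //; last 2 first.
- by move=> x _; rewrite lee_fin.
- exact: measurable_funTS.
have E1 : (\int[nu]_(x in inner Y rho) (L * eta)%:E <= (L * eta)%:E)%E.
  rewrite integral_cst // -[leRHS]mule1; apply: lee_wpmul2l.
    by rewrite lee_fin mulr_ge0 // ltW.
  exact: probability_le1.
have E2 : (\int[nu]_(x in inner Y rho) (S x)%:E <= (eta ^+ 2)%:E)%E.
  apply: le_trans (hN m n Nm Nn); apply: ge0_subset_integral => //.
  - exact: measurable_funTS.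
  - by move=> x _; rewrite lee_fin.
apply: (@le_trans _ _ ((L * eta)%:E + (L / eta)%:E * (eta ^+ 2)%:E)%E).
  by apply: leeD => //; apply: lee_wpmul2l.
rewrite -EFinM -EFinD lee_fin le_eqVlt; apply/orP; left; apply/eqP.
rewrite /eta; field.
by rewrite !gt_eqF.
Qed.

End MaximizingSequence.

(** * The maximizer *)

Section LimitMaximizer.
Variables (R : realType) (d : nat).
Hypothesis hd : (0 < d)%N.
Local Notation V := (d.-tuple R).
Implicit Types (x y : V) (e : R).
Variable leb : {measure set V -> \bar R}.
Hypothesis hleb : is_lebesgue leb.
Variables X Y : set V.
Hypotheses (hXo : eopen X) (hYo : eopen Y) (hYb : ebounded Y).
Variables mu nu : probability V R.
Hypotheses (hmu : probs_on X mu) (hnu : probs_on Y nu).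
Variable D : R.
Hypothesis D0 : 0 <= D.
Hypothesis hD : forall x y, X x -> Y y -> sqdist x y <= D.
Variable f : V -> R.
Hypotheses (mf : measurable_fun setT f) (f0 : forall x, 0 <= f x).
Hypothesis nuE : forall A, measurable A -> nu A = (\int[leb]_(x in A) (f x)%:E)%E.
Variable c : R.
Hypotheses (c0 : 0 < c) (hcf : forall y, Y y -> c <= f y).

Local Notation D2v := (D2 leb X Y mu nu).

Lemma density_lower A : measurable A -> A `<=` Y -> (c%:E * leb A <= nu A)%E.
Proof.
move=> mA AY; rewrite nuE // -integral_cst //; apply: ge0_le_integral => //.
- by move=> x _; rewrite lee_fin ltW.
- by apply/measurable_EFinP; exact: measurable_funTS.
- by move=> x /AY Yx; rewrite lee_fin hcf.
Qed.

Lemma density_upper A (k : R) : measurable A -> (forall x, A x -> f x <= k) ->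
  (nu A <= k%:E * leb A)%E.
Proof.
move=> mA fk; rewrite nuE // -integral_cst //; apply: ge0_le_integral => //.
- by move=> x _; rewrite lee_fin.
- by apply/measurable_EFinP; exact: measurable_funTS.
Qed.

(** Sets well inside [Y] on which nu is at most [n%:R] times [leb], as [jlimsup_integral_le]
    requires; they exhaust [Y] although the density may be unbounded. *)
Definition core n : set V := inner Y n.+1%:R^-1 `&` [set x | f x <= n%:R].

Lemma measurable_core n : measurable (core n).
Proof.
apply: measurableI; first by apply: measurable_inner; rewrite invr_gt0.
rewrite (_ : mkset _ = setT `&` f @^-1` `]-oo, n%:R]); first exact: mf.
by rewrite setTI; apply/seteqP; split => x /=; rewrite in_itv.
Qed.

Lemma core_nondecreasing : nondecreasing_seq core.
Proof.
move=> n m nm; apply/subsetPset => x [hx fx]; split => /=.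
  by apply: inner_mono hx; rewrite ?invr_gt0 // lef_pV2 ?posrE // ler_nat ltnS.
by apply: le_trans fx _; rewrite ler_nat.
Qed.

Lemma bigcup_core : \bigcup_n core n = Y.
Proof.
apply/seteqP; split => [x [n _ [hx _]]|x Yx].
  by apply: inner_sub hx; rewrite invr_gt0.
have [r r0 hr] := mem_inner hYo Yx.
have [N hN] := natSinv_lt r0.
exists (maxn N (Num.truncn (f x)).+1) => //; split => /=.
  by apply: inner_mono hr; rewrite ?invr_gt0 // ltW // hN // leq_maxl.
apply: le_trans (ltW (truncnS_gt (f x))) _.
by rewrite ler_nat leq_maxr.
Qed.

Lemma exists_maximizer : exists p : V -> R,
  [/\ [/\ measurable_fun setT p, forall y, 0 <= p y &
      (\int[nu]_(y in Y) (p y)%:E)%E \is a fin_num],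
      subharmonic leb Y (EFin \o p) & (D2v <= Jfun X Y mu nu (EFin \o p))%E].
Proof.
have hc := density_lower.
have [h_ [hm hcau]] := maximizing_cauchy_leb hd hleb hXo hYo hmu hnu D0 hD c0 hc.
have ah n : adm leb Y (h_ n) by case: (hm n).
have hC n : (\int[nu]_(y in Y) (h_ n y)%:E <= (D + 1)%:E)%E by case: (hm n).
have h0 n := adm_ge0 (ah n).
pose p := jlimsup Y h_.
have mp : measurable_fun setT p := measurable_jlimsup hd hleb hYo c0 hc ah hC.
have p0 y : 0 <= p y := jlimsup_ge0 hd hleb hYo c0 hc ah hC y.
have shp := jlimsup_subharmonic hd hleb hYo c0 hc ah hC.
have mX : measurable X by exact: eopen_measurable.
have mY : measurable Y by exact: eopen_measurable.
have muX : (mu X < +oo)%E by rewrite hmu ltry.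
pose v := fine D2v.
have vE : D2v = v%:E := D2vE hleb hXo hYo hmu hnu D0 hD.
pose A := fine (\int[mu]_(x in X) Q2 Y (EFin \o p) x)%E.
have AE : (\int[mu]_(x in X) Q2 Y (EFin \o p) x = A%:E)%E.
  by rewrite /A fineK //; exact: (Q2_int_fin hXo hmu hnu hD).
(* The nu-mean of [h_ n] is at most [D + 1], so it cannot exceed [D + 2] everywhere on [Y]. This
   bounds the transforms on [X] by [D + 2 + D], uniformly in [n]. *)
have hlow n y : exists2 y, Y y & h_ n y <= D + 2.
  apply: contrapT => /forall2NP nh.
  have hge z : Y z -> D + 2 <= h_ n z.
    by move=> Yz; have [//|/negP] := nh z; rewrite -ltNge => /ltW.
  have : ((D + 2)%:E <= (D + 1)%:E)%E.
    apply: le_trans (hC n); rewrite -(int_cst_nu hYo hnu (D + 2)).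
    apply: ge0_le_integral => //.
    - by move=> z _; rewrite lee_fin addr_ge0.
    - by apply: (adm_measurableE hYo).
  by rewrite lee_fin; lra.
have core_le N : (\int[nu]_(x in core N) (p x)%:E <= (A - v)%:E)%E.
  have N0 : 0 < N.+1%:R^-1 :> R by rewrite invr_gt0.
  have hk B : measurable B -> B `<=` core N -> (nu B <= N%:R%:E * leb B)%E.
    by move=> mB BN; apply: density_upper => // x /BN [].
  apply/lee_addgt0Pr => e e0; have e2 : 0 < e / 2 by rewrite divr_gt0.
  have [N1 hN1] := jlimsup_integral_le hd hleb hYo hYb c0 hc ah hC hcau N0
     (measurable_core N) (@subIsetl _ _ _) (ler0n _ _) hk e2.
  have [N2 hN2] := natSinv_lt e2.
  (* The shifted index makes every estimate hold from [n = 0] on, as [reverse_fatou] expects. *)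
  pose m n := (n + maxn N1 N2)%N.
  have gfin : (\int[nu]_(x in core N) (p x)%:E)%E \is a fin_num.
    rewrite ge0_fin_numE; last by apply: integral_ge0 => x _; rewrite lee_fin.
    apply: le_lt_trans (hN1 N1 (leqnn _)) _.
    by apply: le_lt_trans (leeD (hC N1) (lexx _)) _; rewrite -EFinD ltry.
  rewrite -(fineK gfin) -EFinD lee_fin; set g := fine _.
  (* Near-maximality bounds the integral of the transform of [h_ (m n)] below by [v - e / 2] plus
     the nu-integral of [h_ (m n)], itself at least [g - e / 2]; reverse Fatou carries this over to
     [A]. *)
  suff : v + g - e <= A by lra.
  rewrite -lee_fin -AE.
  apply: (@reverse_fatou _ _ _ mu _ mX muX (fun n => Q2 Y (EFin \o h_ (m n))) _ (D + 2 + D)).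
  - by move=> n; apply: measurable_funTS; exact: measurable_Q2.
  - by apply: measurable_funTS; exact: measurable_Q2.
  - move=> n x Xx; have [y Yy hy] := hlow (m n) x.
    exact: (Q2_bounded hD (h0 _) Yy).
  - move=> x Xx t /(@Q2_limsup _ _ _ h_) [|M hM].
      move=> y Yy u; move=> /(jlimsup_lt hd hleb hYo c0 hc ah hC Yy) [M hM].
      exists M => n Mn; apply: hM => //; first by rewrite eudistxx invr_gt0.
    by exists M => n Mn; apply: hM; rewrite /m (leq_trans Mn) // leq_addr.
  - move=> n; have hm1 : (N1 <= m n)%N.
      by rewrite /m (leq_trans (leq_maxl N1 N2)) // leq_addl.
    have hm2 : (N2 <= m n)%N.
      by rewrite /m (leq_trans (leq_maxr N1 N2)) // leq_addl.
    have [_ _ hJ] := hm (m n).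
    have := hN1 _ hm1; have := hN2 _ hm2.
    move: hJ; rewrite (JE hXo hYo hmu hnu hD (ah _)) vE -EFinB lee_fin.
    rewrite -(fineK (Q2_int_fin hXo hmu hnu hD (h0 (m n)))).
    rewrite -(fineK (adm_int_fin hYo hnu (ah (m n)))) -(fineK gfin) -EFinD !lee_fin -/g /=.
    by move: ((m n).+1%:R^-1) => q; lra.
(* The bound on the cores does not depend on [N], so monotone convergence extends it to [Y]. *)
have pint : (\int[nu]_(y in Y) (p y)%:E <= (A - v)%:E)%E.
  have := @ge0_nondecreasing_set_cvg_integral _ _ _ core (EFin \o p) nu core_nondecreasing
    measurable_core (fun i => measurable_funTS ((measurable_EFinP _ _).2 mp)) (fun i x _ => p0 x).
  rewrite bigcup_core => cv; apply: (cvge_le _ cv).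
  exact: nearW.
have pfin : (\int[nu]_(y in Y) (p y)%:E)%E \is a fin_num.
  rewrite ge0_fin_numE ?(le_lt_trans pint) ?ltry //.
  by apply: integral_ge0 => y _; rewrite lee_fin.
exists p; split => //.
move: pint; rewrite vE /Jfun AE -(fineK pfin) -EFinB !lee_fin; lra.
Qed.

End LimitMaximizer.

Lemma bounded_sqdist (R : realType) (d : nat) (X Y : set (d.-tuple R)) :
  ebounded X -> ebounded Y ->
  exists2 D : R, 0 <= D & forall x y, X x -> Y y -> sqdist x y <= D.
Proof.
move=> [M hM] [N hN]; exists ((`|M| + `|N|) ^+ 2); first exact: sqr_ge0.
move=> x y Xx Yy; rewrite -eudist_sqr ler_pXn2r ?nnegrE ?eudist_ge0 ?addr_ge0 //.
have := eudist_triangle x (origin R d) y; rewrite (eudistC (origin R d) y) -!enormE => h.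
apply: le_trans h _; apply: lerD.
  by apply: le_trans (hM x Xx) _; exact: ler_norm.
by apply: le_trans (hN y Yy) _; exact: ler_norm.
Qed.
Theorem mainTheorem16 (R : realType) (d : nat) (hd : (0 < d)%N)
  (leb : {measure set (d.-tuple R) -> \bar R}) (hleb : is_lebesgue leb)
  (X Y : set (d.-tuple R))
  (hXo : eopen X) (hXb : ebounded X) (hXc : econvex X)
  (hYo : eopen Y) (hYb : ebounded Y) (hYc : econvex Y)
  (mu nu : probability (d.-tuple R) R)
  (hmu : probs_on X mu) (hnu : probs_on Y nu)
  (hdens : exists f : d.-tuple R -> R,
     [/\ measurable_fun setT f,
         (forall x, 0 <= f x),
         (forall A, measurable A -> nu A = (\int[leb]_(x in A) (f x)%:E)%E) &
         exists2 c : R, 0 < c & forall y, Y y -> c <= f y]) :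
  exists psi0 : d.-tuple R -> \bar R,
    [/\ subharmonic leb Y psi0, bounded_below_on Y psi0,
        nu.-integrable Y psi0,
        (D2 leb X Y mu nu <= Jfun X Y mu nu psi0)%E &
        forall mubar : probability (d.-tuple R) R,
          Psh_le leb Y nu mubar ->
          (forall eta, Psh_le leb Y nu eta -> (T2 mu mubar <= T2 mu eta)%E) ->
          (\int[mubar]_(y in Y) psi0 y <= \int[nu]_(y in Y) psi0 y)%E ->
          D2 leb X Y mu nu = Jfun X Y mu nu psi0].
Proof.
have [f [mf f0 nuE [c c0 hcf]]] := hdens.
have [D D0 hD] := bounded_sqdist hXb hYb.
have [p [[mp p0 pfin] shp Jp]] := exists_maximizer hd hleb hXo hYo hYb hmu hnu D0 hD mf f0 nuE c0 hcf.
have [t /andP[t0 t1] Et] := D2_eq_J_scale hleb hXo hYo hmu hnu D0 hD mp p0 pfin Jp.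
exists (fun y => (t * p y)%:E); split.
- exact: subharmonic_scale.
- by exists 0 => y _; rewrite lee_fin mulr_ge0.
- have mY : measurable Y by exact: eopen_measurable.
  under eq_fun do rewrite EFinM; apply: integrableZl => //.
  apply/integrableP; split; first by apply/measurable_EFinP; exact: measurable_funTS.
  rewrite (_ : (\int[nu]_(y in Y) _ = \int[nu]_(y in Y) (p y)%:E)%E).
    by rewrite -ge0_fin_numE //; apply: integral_ge0 => y _; rewrite lee_fin.
  by apply: eq_integral => y _; rewrite gee0_abs // lee_fin.
- by rewrite Et.
- by move=> *; exact: Et.
Qed.
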